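(* If the market filtration is $\mathbb G=\mathbb F^\beta$, then the price $S_t(\kappa,\delta,0,T)$ at time $t$ of a Credit Default Swap (with interest rate $r=0$) is given by $$S_t(\kappa,\delta,0,T)=\mathbf E\left[\delta(\tau)\mathbb I_{\{t<\tau\le T\}}-\kappa\big((\tau\wedge T)-t\big)\mathbb I_{\{t<\tau\}}\,\big|\,\mathcal F^\beta_t\right]$$ $$=\mathbb I_{\{t<\tau\}}\left(-\int_t^T\delta(v)\,d_v\Psi_t(v)-\kappa\int_t^T\Psi_t(v)\,dv\right),$$ where $$\Psi_t(u):=\mathbf P(u<\tau\,|\,\mathcal F^\beta_t)=\int_u^{+\infty}\phi_t(v,\beta_t)\,dF(v)$$ and the notation $d_v\Psi_t(v)$ means that the integral is computed using $v$ as integrating variable.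
   Context: Setting. $(\Omega,\mathcal F,\mathbf P)$ is a complete probability space and $\mathcal N_P$ is the collection of its $\mathbf P$-null sets. $W=(W_t)_{t\ge0}$ is a standard Brownian motion with continuous paths starting from $0$. $\tau:\Omega\to(0,\infty)$ is a strictly positive random variable (the default time) with distribution function $F(t)=\mathbf P(\tau\le t)$. It is assumed throughout that $\tau$ and $W$ are independent and that $\tau$ is not a stopping time of the completed natural filtration of $W$ (so the case in which $\tau$ equals a positive constant is not considered). The information process is $\beta_t:=W_t-\frac{t}{\tau\vee t}W_{\tau\vee t}$, $t\ge0$. With $\mathcal F^0_t:=\sigma(\beta_s,\,0\le s\le t)$, the filtration $\mathbb F^\beta=(\mathcal F^\beta_t)_{t\ge0}$ is given by $\mathcal F^\beta_t:=\sigma(\bigcap_{u>t}\mathcal F^0_u\cup\mathcal N_P)$. $\mathbb I_A$ denotes the indicator function of $A$. Credit Default Swap. Let $T>0$ be the maturity, $\kappa>0$ the rate at which the fee is paid continuously in time, $\delta:[0,T]\to\mathbb R_+$ a positive function (the recovery), and $r$ the constant default-free spot interest rate. If the pricing measure is $\mathbf P$ and the market filtration is $\mathbb G=(\mathcal G_t)_{t\ge0}$, the price at time $t$ is by definition $$S_t(\kappa,\delta,r,T):=e^{rt}\,\mathbf E\left[e^{-r\tau}\delta(\tau)\mathbb I_{\{t<\tau\le T\}}-\int_{t\wedge\tau}^{T\wedge\tau}e^{-rv}\kappa\,dv\,\Big|\,\mathcal G_t\right];$$ here it is assumed that $r=0$. Let $p(t,x,y):=(2\pi t)^{-1/2}\exp(-(x-y)^2/(2t))$,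 $x\in\mathbb R$, be the Gaussian density with variance $t$ and mean $y$, and let $$\varphi_t(r,x):=\begin{cases}p\left(\frac{t(r-t)}{r},x,0\right),&0<t<r,\ x\in\mathbb R,\\ 0,& r\le t,\ x\in\mathbb R,\end{cases}\qquad \phi_t(r,x):=\frac{\varphi_t(r,x)}{\int_{(t,+\infty)}\varphi_t(v,x)\,dF(v)}$$ (in these two formulas $r>0$ is a real variable, not the interest rate).
   Formalization: The identity P(u<τ|F_t)=∫_u^∞ φ_t(v,β_t)dF(v) is stated a.s. on {t<τ} and for t>0 only: on {τ≤t} it fails (there β_t=0 and the integral need not vanish for u≥t), and φ_0 is undefined; the price is taken for 0≤t≤T. *)

(* Defs.v *)
From HB Require Import structures.
From mathcomp Require Import all_boot all_order all_algebra.
From mathcomp Require Import all_classical all_reals all_analysis.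
From mathcomp Require Import measurable_realfun.

Set Implicit Arguments.
Unset Strict Implicit.
Unset Printing Implicit Defensive.

Import Order.TTheory GRing.Theory Num.Theory.
Import numFieldNormedType.Exports.

Local Open Scope classical_set_scope.
Local Open Scope ring_scope.

(* Stochastic processes are families [X : R -> Omega -> R]; only the times
   [t >= 0] are ever used. *)

Section processes.
Context {d : measure_display} {Omega : measurableType d} {R : realType}.
Variable P : probability Omega R.

Definition process_sigma (X : R -> Omega -> R) (I : set R) : set (set Omega) :=
  <<s \bigcup_(s in I) preimage_set_system setT (X s) measurable >>.

Definition natural_filtration (X : R -> Omega -> R) (t : R) : set (set Omega) :=
  process_sigma X `[0, t].

Definition completed_filtration (X : R -> Omega -> R) (t : R) :
    set (set Omega) :=
  <<s natural_filtration X t `|` P.-negligible >>.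

Definition right_completed_filtration (X : R -> Omega -> R) (t : R) :
    set (set Omega) :=
  <<s (\bigcap_(u in `]t, +oo[) natural_filtration X u) `|` P.-negligible >>.

Definition is_stopping_time (G : R -> set (set Omega)) (tau : Omega -> R) :
    Prop :=
  forall t, 0 <= t -> G t [set w | tau w <= t].

Record is_brownian_motion (W : R -> Omega -> R) : Prop := {
  bm_measurable : forall t, 0 <= t -> measurable_fun setT (W t) ;
  bm_start : forall w, W 0 w = 0 ;
  bm_continuous :
    forall w, {within `[0, +oo[, continuous (fun t => W t w)} ;
  bm_gaussian : forall s t, 0 <= s -> s < t ->
    forall B : set R, measurable B ->
    P [set w | B (W t w - W s w)] = normal_prob 0 (Num.sqrt (t - s)) B ;
  (* taking [B i = setT] gives the product rule for every subfamily *)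
  bm_indep_increments : forall (n : nat) (s : nat -> R),
    0 <= s 0%N -> (forall i, s i < s i.+1) ->
    forall B : nat -> set R, (forall i, measurable (B i)) ->
    P (\bigcap_(i in `I_n) [set w | B i (W (s i.+1) w - W (s i) w)]) =
    (\prod_(i < n) P [set w | B i (W (s i.+1) w - W (s i) w)%R])%E }.

Definition independent_of_process (tau : Omega -> R) (W : R -> Omega -> R) :
    Prop :=
  forall A B : set Omega,
    preimage_set_system setT tau measurable A ->
    process_sigma W `[0, +oo[ B ->
    P (A `&` B) = (P A * P B)%E.

(* [X] need not be integrable: it is enough that its positive or its negative
   part is, in which case the conditional expectation is [\bar R]-valued. *)
Definition is_cond_exp (G : set (set Omega)) (X : Omega -> R)
    (Y : Omega -> \bar R) : Prop :=
  [/\ measurable_fun setT X,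
      (\int[P]_w (Num.max (X w) 0)%:E < +oo)%E \/
        (\int[P]_w (Num.max (- X w) 0)%:E < +oo)%E,
      (preimage_set_system setT Y measurable `<=` G) &
      (forall A, G A -> \int[P]_(w in A) Y w = \int[P]_(w in A) (X w)%:E)%E].

(* A chosen version; it is determined up to a null set. *)
Definition cond_exp (G : set (set Omega)) (X : Omega -> R) : Omega -> \bar R :=
  xget (cst 0%E) [set Y | is_cond_exp G X Y].

Definition cond_prob (G : set (set Omega)) (A : set Omega) : Omega -> \bar R :=
  cond_exp G \1_A.

End processes.

Section stieltjes.
Context {R : realType}.

(* The measure [dg] when [g] is nondecreasing and right-continuous. *)
Definition stieltjes_measure (g : R -> R) :
    {measure set (measurableTypeR R) -> \bar R} :=
  match pselect (nondecreasing g /\ right_continuous g) with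
  | left h => lebesgue_stieltjes_measure
                (HB.pack_for (cumulative R R) g
                  (isCumulative.Build R _ R g h.1 h.2))
  | right _ => mzero
  end.

(* [\int_a^b f(v) d_v G(v)] for a nonincreasing right-continuous [G]: the
   measure [dG] is minus the measure [d(-G)], and the domain is ]a, b]. *)
Definition stieltjes_integral_decr (f G : R -> R) (a b : R) : \bar R :=
  (- \int[stieltjes_measure (fun v => - G v)%R]_(v in `]a, b]) (f v)%:E)%E.

End stieltjes.

Section information_process.
Context {d : measure_display} {Omega : measurableType d} {R : realType}.
Variable P : probability Omega R.

Definition information_process (W : R -> Omega -> R) (tau : Omega -> R)
    (t : R) (w : Omega) : R :=
  W t w - t / Num.max (tau w) t * W (Num.max (tau w) t) w.

Definition default_cdf (tau : {RV P >-> R}) (t : R) : R := fine (cdf tau t).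

Section default_cdf_cumulative.
Variable tau : {RV P >-> R}.

Let default_cdf_nd : nondecreasing (default_cdf tau).
Proof. by move=> *; rewrite fine_le ?fin_num_measure// cdf_nondecreasing. Qed.

Let default_cdf_rc : right_continuous (default_cdf tau).
Proof.
move=> a; apply: fine_cvg.
by rewrite fineK ?fin_num_measure//; exact: cdf_right_continuous.
Qed.

HB.instance Definition _ := isCumulative.Build R _ R (default_cdf tau)
  default_cdf_nd default_cdf_rc.

End default_cdf_cumulative.

Definition gauss_density (t x y : R) : R :=
  (Num.sqrt (2 * pi * t))^-1 * expR (- (x - y) ^+ 2 / (2 * t)).

Definition bridge_density (t r x : R) : R :=
  if 0 < t < r then gauss_density (t * (r - t) / r) x 0 else 0.

Definition posterior_density (tau : {RV P >-> R}) (t r x : R) : R :=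
  bridge_density t r x /
  \int[lebesgue_stieltjes_measure (default_cdf tau)]_(v in `]t, +oo[)
     bridge_density t v x.

(* The process [beta] is evaluated at time [t]. The lower end [u] is excluded
   since the event is [u < tau]. *)
Definition posterior_survival (tau : {RV P >-> R}) (beta : R -> Omega -> R)
    (t u : R) (w : Omega) : R :=
  \int[lebesgue_stieltjes_measure (default_cdf tau)]_(v in `]u, +oo[)
     posterior_density tau t v (beta t w).

(* [Psi u] is [P(u < tau | G)], in a version whose paths [u |-> Psi u w] are
   survival functions, so that [d_v Psi v] makes sense. Before default only:
   on [tau <= t] the conditional law is the Dirac mass at [tau], and the price
   carries the factor [\1_(t < tau)]. *)
Definition is_survival_version (G : set (set Omega)) (tau : Omega -> R) (t : R)
    (Psi : R -> Omega -> R) : Prop :=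
  (forall u, {ae P, forall w, t < tau w ->
     cond_prob P G [set w' | u < tau w'] w = (Psi u w)%:E}) /\
  {ae P, forall w, t < tau w ->
     nonincreasing_fun (fun u => Psi u w) /\ right_continuous (fun u => Psi u w)}.

End information_process.

Section credit_default_swap.
Context {d : measure_display} {Omega : measurableType d} {R : realType}.
Variable P : probability Omega R.

(* Meant for [0 <= t <= T]: the fee leg is then an integral over an interval
   with ordered endpoints. *)
Definition cds_cashflow (kappa : R) (delta : R -> R) (r T t : R)
    (tau : Omega -> R) (w : Omega) : R :=
  expR (- (r * tau w)) * delta (tau w) * \1_[set w' | t < tau w' <= T] w -
  \int[lebesgue_measure]_(v in `[Num.min t (tau w), Num.min T (tau w)])
     (expR (- (r * v)) * kappa).

Definition cds_price (G : R -> set (set Omega)) (tau : Omega -> R)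
    (kappa : R) (delta : R -> R) (r T t : R) (w : Omega) : \bar R :=
  ((expR (r * t))%:E * cond_exp P (G t) (cds_cashflow kappa delta r T t tau) w)%E.

Definition cds_formula (tau : Omega -> R) (kappa : R) (delta : R -> R) (T t : R)
    (Psi : R -> Omega -> R) (w : Omega) : \bar R :=
  ((\1_[set w' | t < tau w'] w)%:E *
   (- stieltjes_integral_decr delta (fun v => Psi v w) t T -
    (kappa * \int[lebesgue_measure]_(v in `[t, T]) Psi v w)%:E))%E.

End credit_default_swap.

(* Main.v *)
Require Import Defs.
From HB Require Import structures.
From mathcomp Require Import all_boot all_order all_algebra.
From mathcomp Require Import all_classical all_reals all_analysis.
From mathcomp Require Import measurable_realfun ring lra.
Import Order.TTheory GRing.Theory Num.Theory.
Import numFieldNormedType.Exports.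

(** The proof has two halves: the conditional law of the default time, and the
    pricing formula, which follows from any version of that law.

    For the conditional law, the key is that for [u <= s < tau] the information
    process splits as [beta u = (W u - u / s * W s) + u / s * beta s]. The first
    summand is the bridge of [W] of length [s]; it does not involve [tau]. Over
    [ ]0, s[ ] this bridge is independent of [W s - s / r * W r] for every [r >
    s] ([bridge_past_indep]), and [beta s = 0] if [tau <= s]; since [tau] is
    independent of [W], the bridge is independent of the pair [(tau, beta s)]
    ([past_default_indep]). On [s < tau], therefore, [beta s] carries everything
    that the path of [beta] up to time [s] tells about [tau], and the joint
    density [bridge_density s r x] of [(tau, beta s)] gives the conditional law
    by the formula of Bayes ([bayes_natural]). Letting [s] decrease to [t], by
    dominated convergence, replaces the natural filtration by its
    right-continuous version ([bayes_right]), and null sets change nothing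
    ([bayes_filtration]). So [posterior_survival] is a version of the
    conditional survival function ([posterior_survival_version]).

    The independence of bridges comes from the independent increments of [W]: if
    [X] and [Y] are independent centred Gaussian variables with variances [a]
    and [b], then [X - a / (a + b) * (X + Y)] and [X + Y] are independent too
    ([gauss_rotation]). Applied along an increasing chain of times, this trades
    the increments one by one for bridges between consecutive times
    ([chain_bridges]).

    For the price, let [Psi] be any version of the conditional survival
    function. On [t < tau], minus its differential, restricted to [ ]t, T] ], is
    a random measure [survival_kernel]. It gives the right mass to half-open
    intervals by definition of [Psi], hence to all Borel sets by the pi-lambda
    theorem ([survival_kernel_represents]): it is the conditional law of [tau]
    on [ ]t, T] ]. Integrating [delta] and [v - t] against it gives the
    conditional expectations of the recovery and of the fee paid until a default
    before maturity ([integral_survival_kernel]). Exchanging the order of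
    integration turns the integral of [v - t] into that of [Psi v - Psi T] over
    [ [t, T] ] ([integral_tail]); the fee paid when [T < tau] restores [Psi T].

    The recovery may have infinite mean, so the conditional expectations are
    extended-real. The negative part of the payoff is bounded by the fee, which
    makes the differences meaningful ([ge0_integralB_fin]), and versions are
    compared on sets [Y' < q < q' < Y] with rational [q] and [q']
    ([ae_le_integral_sub]). *)

Set Implicit Arguments.
Unset Strict Implicit.
Unset Printing Implicit Defensive.

Local Open Scope classical_set_scope.
Local Open Scope ring_scope.

(** * Independence and conditional expectation *)

Section image_measure.
Context {d1 d2 : measure_display} {T1 : measurableType d1}
  {T2 : measurableType d2} {R : realType}.
Variables (m : {finite_measure set T1 -> \bar R}) (f : T1 -> T2).
Hypothesis mf : measurable_fun setT f.

(** The measurability proof is an argument: it lets the measure structure be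
    inferred from the term. *)
Definition image_measure & measurable_fun setT f := pushforward m f.

Let image0 : image_measure mf set0 = 0%E.
Proof. exact: measure0. Qed.

Let image_ge0 A : (0 <= image_measure mf A)%E.
Proof. exact: measure_ge0. Qed.

Let image_sigma_additive : semi_sigma_additive (image_measure mf).
Proof. exact: measure_semi_sigma_additive. Qed.

HB.instance Definition _ := isMeasure.Build _ _ _ (image_measure mf)
  image0 image_ge0 image_sigma_additive.

Let image_fin : fin_num_fun (image_measure mf).
Proof.
move=> A mA; apply: fin_num_measure.
by rewrite -[X in measurable X]setTI; exact: mf.
Qed.

HB.instance Definition _ := Measure_isFinite.Build _ _ _ (image_measure mf)
  image_fin.

End image_measure.

Section indep_systems.
Context {d : measure_display} {Omega : measurableType d} {R : realType}.
Variable P : probability Omega R.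

Definition indep_systems (F G : set (set Omega)) :=
  forall A B, F A -> G B -> P (A `&` B) = (P A * P B)%E.

Lemma indep_systemsS F G F' G' : F' `<=` F -> G' `<=` G ->
  indep_systems F G -> indep_systems F' G'.
Proof. by move=> F'F G'G FG A B /F'F FA /G'G GB; exact: FG. Qed.

(** For fixed [B] in [G], [P (A `&` B)] and [P A * P B] are finite measures in
    [A] that agree on the pi-system [F]. *)
Lemma indep_systems_gen F G : setI_closed F -> F setT ->
  F `<=` measurable -> G `<=` measurable ->
  indep_systems F G -> indep_systems <<s F >> G.
Proof.
move=> FI FT Fm Gm FG A B sFA GB.
have mB := Gm _ GB.
have [p pE] : exists p : {nonneg R}, P B = (p%:num)%:E.
  have PB0 : 0 <= fine (P B) by rewrite fine_ge0.
  by exists (NngNum PB0); rewrite fineK// fin_num_measure.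
rewrite pE muleC.
apply: (g_sigma_algebra_measure_unique F Fm (fun=> setT) (fun=> FT) _
  (mrestr P mB) (mscale p P)) => //.
- by rewrite bigcup_const.
- by move=> C FC; apply: (etrans (FG _ _ FC GB)); rewrite muleC pE.
- by move=> _; rewrite ltey_eq fin_num_measure.
Qed.

End indep_systems.

Section sub_sigma_algebra.
Context {d : measure_display} {Omega : measurableType d} {R : realType}.
Variable P : probability Omega R.
Variable G : set (set Omega).
Hypothesis Gm : <<s G >> `<=` @measurable d Omega.

Local Notation OG := (g_sigma_algebraType G).

Lemma adaptedE d' (T : measurableType d') (Y : Omega -> T) :
  preimage_set_system setT Y measurable `<=` <<s G >> <->
  measurable_fun (setT : set OG) (Y : OG -> T).
Proof.
split=> [h _ B mB|h _ [B mB] <-]; first by apply: h; exists B.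
exact: h.
Qed.

Lemma measurable_id_sub : measurable_fun setT (id : Omega -> OG).
Proof. by move=> _ B mB; rewrite setTI; exact: Gm. Qed.

Lemma measurable_fun_sub d' (T : measurableType d') (Y : Omega -> T) :
  measurable_fun (setT : set OG) (Y : OG -> T) -> measurable_fun setT Y.
Proof. by move=> h; apply: (measurableT_comp h); exact: measurable_id_sub. Qed.

(** The restriction of [m] to a smaller sigma-algebra is its image by the
    identity: the two sigma-algebras are carried by two types. *)
Definition sub_measure (m : {finite_measure set Omega -> \bar R}) :
    {finite_measure set OG -> \bar R} :=
  image_measure m measurable_id_sub.

Lemma ge0_integral_sub (m : {finite_measure set Omega -> \bar R})
    (A : set Omega) (Y : Omega -> \bar R) :
  <<s G >> A -> measurable_fun (setT : set OG) (Y : OG -> \bar R) ->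
  (forall w, 0 <= Y w)%E ->
  (\int[sub_measure m]_(w in A) (Y : OG -> \bar R) w =
   \int[m]_(w in A) Y w)%E.
Proof.
move=> GA mY Y0; rewrite ge0_integral_pushforward//.
- exact: measurable_id_sub.
- exact: measurable_funTS.
Qed.

(** The density of [P (A `&` C)] with respect to [P], both restricted to
    [<<s G >>], can be taken nonnegative and finite everywhere. *)
Lemma cond_prob_density (C : set Omega) : measurable C ->
  exists2 y : Omega -> R, forall w, 0 <= y w &
    is_cond_exp P <<s G >> \1_C (EFin \o y).
Proof.
move=> mC.
have dom : sub_measure (mrestr P mC) `<< sub_measure P.
  apply/null_content_dominatesP => A mA /= PA0; apply/eqP.
  rewrite eq_le measure_ge0 andbT -[leRHS]PA0 /image_measure /pushforward.
  rewrite /mrestr; apply: le_measure; rewrite ?inE//.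
  - by apply: measurableI => //; exact: Gm.
  - exact: Gm.
have [f [f0 ffin fint fE]] := radon_nikodym_sigma_finite dom.
have mf := measurable_int _ fint.
exists (fine \o f); first by move=> w; rewrite fine_ge0//; exact: f0.
have -> : EFin \o (fine \o f) = (f : Omega -> \bar R).
  by apply/funext => w; rewrite /= fineK.
split.
- exact: measurable_indic.
- right; rewrite (eq_integral (cst 0%E)) ?integral0 ?ltry//.
  by move=> w _; rewrite max_r// oppr_le0.
- exact/adaptedE.
- move=> A GA; rewrite -ge0_integral_sub// -fE//.
  by rewrite integral_indic; [rewrite setIC|exact: Gm|].
Qed.

(** The positive parts compare in one direction and the negative parts in the
    other, so that the difference is monotone even if [f] is not integrable. *)
Lemma ge_cst_integral (c : R) (A : set Omega) (f : Omega -> \bar R) :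
  measurable A -> measurable_fun setT f -> (forall w, A w -> c%:E <= f w)%E ->
  (c%:E * P A <= \int[P]_(w in A) f w)%E.
Proof.
move=> mA mf cf; rewrite -integral_cst// integralE [leRHS]integralE.
have mfA := measurable_funS measurableT (@subsetT _ A) mf.
apply: leeB; apply: ge0_le_integral => //.
- exact: measurable_funepos.
- exact: measurable_funepos.
- by move=> w Aw; rewrite !funeposE ge_max !le_max cf// lexx orbT.
- exact: measurable_funeneg.
- exact: measurable_funeneg.
- by move=> w Aw; rewrite !funenegE ge_max !le_max leeN2 cf// lexx orbT.
Qed.

Lemma le_cst_integral (c : R) (A : set Omega) (f : Omega -> \bar R) :
  measurable A -> measurable_fun setT f -> (forall w, A w -> f w <= c%:E)%E ->
  (\int[P]_(w in A) f w <= c%:E * P A)%E.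
Proof.
move=> mA mf cf; rewrite -integral_cst// [leLHS]integralE [leRHS]integralE.
have mfA := measurable_funS measurableT (@subsetT _ A) mf.
apply: leeB; apply: ge0_le_integral => //.
- exact: measurable_funepos.
- exact: measurable_funepos.
- by move=> w Aw; rewrite !funeposE ge_max !le_max cf// lexx orbT.
- exact: measurable_funeneg.
- exact: measurable_funeneg.
- by move=> w Aw; rewrite !funenegE ge_max !le_max leeN2 cf// lexx orbT.
Qed.

Lemma lte_rat_between (x y : \bar R) : (x < y)%E ->
  exists q, (x < (ratr q)%:E < y)%E.
Proof.
have dense (a b : R) : a < b -> exists q, (a%:E < (ratr q)%:E < b%:E)%E.
  by move=> /rat_in_itvoo[q]; rewrite in_itv/= => h; exists q; rewrite !lte_fin.
case: x y => [a| |] [b| |] //.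
- by rewrite lte_fin; exact: dense.
- move=> _; have [|q /andP[h _]] := dense a (a + 1); first by rewrite ltrDl.
  by exists q; rewrite h ltry.
- move=> _; have [|q /andP[_ h]] := dense (b - 1) b.
    by rewrite ltrBlDr ltrDl.
  by exists q; rewrite h ltNyr.
- by move=> _; exists 0; rewrite ltry ltNyr.
Qed.

(** If [Y' < Y] on a set that is not null, then [Y' < q < q' < Y] on such a set
    for some rational [q] and [q']; there the integrals of [Y'] and [Y] are on
    the wrong sides of [q * P] and [q' * P], which are finite. *)
Lemma ae_le_integral_sub (E : set Omega) (Y Y' : Omega -> \bar R) :
  <<s G >> E ->
  measurable_fun (setT : set OG) (Y : OG -> \bar R) ->
  measurable_fun (setT : set OG) (Y' : OG -> \bar R) ->
  (forall A, <<s G >> A -> A `<=` E ->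
     \int[P]_(w in A) Y w <= \int[P]_(w in A) Y' w)%E ->
  {ae P, forall w, E w -> (Y w <= Y' w)%E}.
Proof.
move=> GE mY mY' YY'.
pose A (q q' : rat) : set OG :=
  (E : set OG) `&` ([set w | (Y' w < (ratr q)%:E)%E] `&`
          [set w | ((ratr q')%:E < Y w)%E]).
have GA q q' : <<s G >> (A q q').
  apply: (@measurableI _ OG) => //; apply: (@measurableI _ OG).
    by rewrite -[X in measurable X]setTI; exact: emeasurable_fun_infty_o.
  by rewrite -[X in measurable X]setTI; exact: emeasurable_fun_o_infty.
have A0 q q' : q < q' -> P (A q q') = 0%E.
  move=> qq'; have mA : @measurable d Omega (A q q') by apply: Gm; exact: GA.
  have h1 : ((ratr q')%:E * P (A q q') <= \int[P]_(w in A q q') Y w)%E.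
    apply: ge_cst_integral => //; first exact: measurable_fun_sub.
    by move=> w [_ [_ /ltW]].
  have h2 : (\int[P]_(w in A q q') Y' w <= (ratr q)%:E * P (A q q'))%E.
    apply: le_cst_integral => //; first exact: measurable_fun_sub.
    by move=> w [_ [/ltW]].
  have /(le_trans h1)/le_trans/(_ h2) : (\int[P]_(w in A q q') Y w <=
      \int[P]_(w in A q q') Y' w)%E.
    by apply: YY' => // w [].
  rewrite -(@fineK _ (P (A q q'))) ?fin_num_measure// -!EFinM lee_fin => h.
  have : 0 <= fine (P (A q q')) by rewrite fine_ge0.
  rewrite le_eqVlt => /predU1P[<-//|h0].
  by move: h; rewrite ler_pM2r// leNgt ltr_rat qq'.
pose F n : set Omega := if (unpickle n : option (rat * rat)) is Some (q, q')
  then (if q < q' then A q q' else set0) else set0.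
have nF : P.-negligible (\bigcup_n F n).
  apply: negligible_bigcup => n; rewrite /F; case: unpickle => [[q q']|].
    case: ifPn => [qq'|_]; last exact: negligible_set0.
    by apply/negligibleP; [apply: Gm; exact: GA|exact: A0].
  exact: negligible_set0.
apply: negligibleS nF => w /= /not_implyP[Ew /negP]; rewrite -ltNge => YY.
have [q /andP[h1 h2]] := lte_rat_between YY.
have [q' /andP[h3 h4]] := lte_rat_between h2.
have Fw : F (pickle (q, q')) w.
  by rewrite /F pickleK; move: h3; rewrite lte_fin ltr_rat => ->; split.
exact: (ex_intro2 _ _ (pickle (q, q')) Logic.I Fw).
Qed.

Lemma ae_eq_integral_sub (E : set Omega) (Y Y' : Omega -> \bar R) :
  <<s G >> E ->
  measurable_fun (setT : set OG) (Y : OG -> \bar R) ->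
  measurable_fun (setT : set OG) (Y' : OG -> \bar R) ->
  (forall A, <<s G >> A -> A `<=` E ->
     \int[P]_(w in A) Y w = \int[P]_(w in A) Y' w)%E ->
  {ae P, forall w, E w -> Y w = Y' w}.
Proof.
move=> GE mY mY' YY'.
have h1 : {ae P, forall w, E w -> (Y w <= Y' w)%E}.
  by apply: ae_le_integral_sub => // A GA AE; rewrite YY'.
have h2 : {ae P, forall w, E w -> (Y' w <= Y w)%E}.
  by apply: ae_le_integral_sub => // A GA AE; rewrite YY'.
apply: filterS2 h1 h2 => w h1 h2 Ew.
by apply/eqP; rewrite eq_le h1// h2.
Qed.

Lemma cond_expP (X : Omega -> R) (Y : Omega -> \bar R) :
  is_cond_exp P <<s G >> X Y -> is_cond_exp P <<s G >> X (cond_exp P <<s G >> X).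
Proof. by move=> h; rewrite /cond_exp; case: xgetP => [Z _ |/(_ Y)/(_ h)]. Qed.

Lemma cond_exp_ae_eq (X : Omega -> R) (Y : Omega -> \bar R) :
  is_cond_exp P <<s G >> X Y ->
  {ae P, forall w, cond_exp P <<s G >> X w = Y w}.
Proof.
move=> XY; have [_ _ /adaptedE mY YE] := XY.
have [_ _ /adaptedE mZ ZE] := cond_expP XY.
have : {ae P, forall w, setT w -> cond_exp P <<s G >> X w = Y w}.
  apply: ae_eq_integral_sub => //; first exact: (@measurableT _ OG).
  by move=> A GA _; rewrite YE// ZE.
by apply: filterS => w; exact.
Qed.

Lemma cond_probP (C : set Omega) : measurable C ->
  is_cond_exp P <<s G >> \1_C (cond_prob P <<s G >> C).
Proof. by move=> mC; have [y _] := cond_prob_density mC; exact: cond_expP. Qed.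

Hypothesis Gnull : P.-negligible `<=` <<s G >>.

(** The set where [Y] and [Y'] differ is null, hence in [<<s G >>], and so is
    each of its subsets. *)
Lemma ae_eq_adapted d' (T : measurableType d') (Y Y' : Omega -> T) :
  {ae P, forall w, Y w = Y' w} ->
  measurable_fun (setT : set OG) (Y : OG -> T) ->
  measurable_fun (setT : set OG) (Y' : OG -> T).
Proof.
move=> YY' mY _ B mB; rewrite setTI.
pose N : set OG := [set w | Y w != Y' w].
have nN : P.-negligible N by apply: negligibleS YY' => w /eqP.
rewrite (_ : _ @^-1` B = ((Y @^-1` B : set OG) `\` N) `|`
   ((Y' @^-1` B : set OG) `&` N)).
  apply: (@measurableU _ OG).
    apply: (@measurableD _ OG); last exact: Gnull.
    by rewrite -[X in measurable X]setTI; exact: mY.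
  by apply: Gnull; apply: negligibleS nN => w [].
apply/seteqP; split => w /=; rewrite /N/=.
  by have [->|] := eqVneq (Y w) (Y' w); [left|right].
by move=> [[BY /negP]|[]//]; rewrite negbK => /eqP <-.
Qed.

End sub_sigma_algebra.

(** * Gaussian densities *)

Section density.
Context {d : measure_display} {T : measurableType d} {R : realType}.
Local Open Scope ereal_scope.

(** Almost everywhere [h] is the Radon-Nikodym derivative of [nu], for which the
    change of variables is known. *)
Lemma ge0_integral_density (mu : {sigma_finite_measure set T -> \bar R})
    (nu : {finite_measure set T -> \bar R}) (h : T -> R) :
  measurable_fun setT h -> (forall x, 0 <= h x)%R ->
  (forall A, measurable A -> nu A = \int[mu]_(x in A) (h x)%:E) ->
  forall (E : set T) (f : T -> \bar R), measurable E ->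
  measurable_fun setT f -> (forall x, 0 <= f x) ->
  \int[nu]_(x in E) f x = \int[mu]_(x in E) (f x * (h x)%:E).
Proof.
move=> mh h0 nuE E f mE mf f0.
have mh' : measurable_fun setT (EFin \o h) by exact/measurable_EFinP.
have dom : nu `<< mu.
  apply/null_content_dominatesP => A mA muA0; rewrite nuE//.
  by rewrite null_set_integral//; exact: measurable_funTS.
have mfE : measurable_fun E f by exact: measurable_funTS.
rewrite -(Radon_Nikodym_SigmaFinite.change_of_variables dom)//.
pose g := Radon_Nikodym_SigmaFinite.f nu mu.
have ig := Radon_Nikodym_SigmaFinite.f_integrable dom.
have gh : ae_eq mu setT g (EFin \o h).
  apply: integral_ae_eq => //.
  by move=> A _ mA; rewrite -Radon_Nikodym_SigmaFinite.f_integral// nuE.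
apply: ge0_ae_eq_integral => //.
- apply: emeasurable_funM => //.
  exact/measurable_funTS/(measurable_int _ ig).
- by apply: emeasurable_funM => //; exact: measurable_funTS.
- move=> x _; apply: mule_ge0 => //.
  exact: Radon_Nikodym_SigmaFinite.f_ge0.
- by move=> x _; apply: mule_ge0 => //; rewrite lee_fin.
- by apply: filterS gh => x ghx _; rewrite -/g ghx.
Qed.

End density.

Lemma measurable_indic_comp {d1 d2 : measure_display} {T1 : measurableType d1}
    {T2 : measurableType d2} {R : realType} (g : T1 -> T2) (B : set T2) :
  measurable_fun setT g -> measurable B ->
  measurable_fun setT (fun x => \1_B (g x) : R).
Proof.
move=> mg mB; rewrite (_ : (fun _ => _) = \1_(g @^-1` B))//.
by apply: measurable_indic; rewrite -[X in measurable X]setTI; exact: mg.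
Qed.

Section lebesgue_translation.
Context {R : realType}.
Local Open Scope ereal_scope.
Local Notation mu := (@lebesgue_measure R).

Lemma lebesgue_measureD (c : R) (A : set R) : measurable A ->
  pushforward mu (fun x => x + c : measurableTypeR R)%R A = mu A.
Proof.
move=> mA; apply/esym.
have mc : measurable_fun setT (fun x : R => x + c : measurableTypeR R)%R.
  exact: measurable_funD.
apply: lebesgue_measure_unique => //= _ [[a b]] _ <-.
rewrite /pushforward.
rewrite (_ : _ @^-1` _ = `]a - c, b - c]%classic)%R; last first.
  by apply/seteqP; split => x /=; rewrite !in_itv/= ltrBlDr lerBrDr.
by rewrite !lebesgue_measure_itv/= !lte_fin ltrD2r; case: ifP => // _;
  rewrite -!EFinB; congr EFin; ring.
Qed.

Lemma ge0_integralD_shift (c : R) (f : R -> \bar R) :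
  measurable_fun setT f -> (forall x, 0 <= f x) ->
  \int[mu]_x f (x + c)%R = \int[mu]_x f x.
Proof.
move=> mf f0.
have mc : measurable_fun setT (fun x : R => x + c : measurableTypeR R)%R.
  exact: measurable_funD.
transitivity (\int[pushforward mu (fun x => x + c : measurableTypeR R)%R]_x f x).
  by rewrite ge0_integral_pushforward.
by apply: eq_measure_integral => A mA _; exact: lebesgue_measureD.
Qed.

End lebesgue_translation.

Section gaussian.
Context {R : realType}.
Local Notation mu := (@lebesgue_measure R).

Lemma gauss_densityE (a x : R) : 0 < a ->
  gauss_density a x 0 = normal_pdf 0 (Num.sqrt a) x.
Proof.
move=> a0; rewrite normal_pdfE ?gt_eqF ?sqrtr_gt0//.
rewrite /normal_peak /normal_fun /gauss_density sqr_sqrtr ?ltW//.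
by congr ((Num.sqrt _)^-1 * expR (_ / _)); rewrite -[RHS]mulr_natl; ring.
Qed.

Lemma measurable_gauss_density (a : R) :
  measurable_fun setT (fun x => gauss_density a x 0).
Proof.
apply: measurable_funM => //; apply: measurableT_comp => //.
apply: measurable_funM => //; apply: measurableT_comp => //.
by apply: measurable_funX; exact: measurable_funB.
Qed.

Lemma gauss_density_ge0 (a x y : R) : 0 <= gauss_density a x y.
Proof. by rewrite mulr_ge0 ?invr_ge0 ?sqrtr_ge0 ?expR_ge0. Qed.

Lemma normal_probE (a : R) (B : set R) : 0 < a ->
  normal_prob 0 (Num.sqrt a) B = (\int[mu]_(x in B) (gauss_density a x 0)%:E)%E.
Proof.
move=> a0; rewrite /normal_prob; apply: eq_integral => x _.
by rewrite gauss_densityE.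
Qed.

(** Completing the square in [x]. *)
Lemma gauss_density_mul (a b x z : R) : 0 < a -> 0 < b ->
  gauss_density a x 0 * gauss_density b (z - x) 0 =
  gauss_density (a * b / (a + b)) (x - a / (a + b) * z) 0 *
  gauss_density (a + b) z 0.
Proof.
move=> a0 b0; rewrite /gauss_density.
have ab0 : 0 < a + b by rewrite addr_gt0.
rewrite [LHS]mulrACA [RHS]mulrACA -!invfM -!expRD -!sqrtrM; last 2 first.
- by rewrite !mulr_ge0 ?invr_ge0 ?pi_ge0 ?ltW.
- by rewrite !mulr_ge0 ?invr_ge0 ?pi_ge0 ?ltW.
congr (_^-1 * expR _).
  by congr Num.sqrt; field; rewrite gt_eqF.
by field; rewrite !gt_eqF.
Qed.

Lemma normal_prob_indic (a : R) (B : set R) : 0 < a -> measurable B ->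
  normal_prob 0 (Num.sqrt a) B =
  (\int[mu]_x (gauss_density a x 0 * \1_B x)%:E)%E.
Proof.
move=> a0 mB; rewrite normal_probE// integral_mkcond.
by apply: eq_integral => x _; rewrite epatch_indic EFinM.
Qed.

(** [X - a / (a + b) * (X + Y)] and [X + Y] are uncorrelated, hence independent,
    when [X] and [Y] are independent centred Gaussian variables with variances
    [a] and [b]. On densities, this is the substitution [z = x + y] followed by
    [gauss_density_mul] and the translation of [x] by [a / (a + b) * z]. *)
Lemma gauss_rotation (a b : R) (B B' : set R) : 0 < a -> 0 < b ->
  measurable B -> measurable B' ->
  (normal_prob 0 (Num.sqrt a) \x normal_prob 0 (Num.sqrt b))%E
    [set xy : R * R | B (xy.1 - a / (a + b) * (xy.1 + xy.2)) /\
                      B' (xy.1 + xy.2)] =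
  (normal_prob 0 (Num.sqrt (a * b / (a + b))) B *
   normal_prob 0 (Num.sqrt (a + b)) B')%E.
Proof.
move=> a0 b0 mB mB'; set D := [set xy | _].
have ab0 : 0 < a + b by rewrite addr_gt0.
have v0 : 0 < a * b / (a + b) by rewrite divr_gt0// mulr_gt0.
set v := a * b / (a + b); pose c := a / (a + b).
have m1 : measurable_fun setT (fun xz : R * R => xz.1 - c * xz.2).
  by apply: measurable_funB => //; exact: measurable_funM.
have m2 : measurable_fun setT (fun xz : R * R => xz.2 - xz.1).
  exact: measurable_funB.
pose F (xz : R * R) := gauss_density b (xz.2 - xz.1) 0 *
  \1_B (xz.1 - c * xz.2) * \1_B' xz.2.
have F0 xz : 0 <= F xz by rewrite !mulr_ge0// gauss_density_ge0.
have mF : measurable_fun setT F.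
  apply: measurable_funM; last first.
    exact: measurable_indic_comp.
  apply: measurable_funM.
    exact: measurableT_comp (measurable_gauss_density b) m2.
  exact: measurable_indic_comp.
have mD : measurable D.
  rewrite /D; apply: measurableI.
    have h : measurable_fun setT (fun xy : R * R => xy.1 - c * (xy.1 + xy.2)).
      apply: measurable_funB => //; apply: measurable_funM => //.
      exact: measurable_funD.
    by rewrite -[X in measurable X]setTI; exact: h.
  have h : measurable_fun setT (fun xy : R * R => xy.1 + xy.2).
    exact: measurable_funD.
  by rewrite -[X in measurable X]setTI; exact: h.
have step1 x : normal_prob 0 (Num.sqrt b) (xsection D x) =
    (\int[mu]_z (F (x, z))%:E)%E.
  rewrite normal_prob_indic//; last exact: measurable_xsection.
  rewrite -[RHS](@ge0_integralD_shift _ x).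
  - apply: eq_integral => y _; congr EFin.
    rewrite /F/= addrK -mulrA; congr *%R.
    rewrite !indicE -natrM mulnb (addrC y x); congr (nat_of_bool _)%:R.
    by apply/idP/andP => [|[]]; rewrite !inE /xsection/= inE.
  - by apply/measurable_EFinP; exact: (measurable_fun_pair2 x mF).
  - by move=> z; rewrite lee_fin.
rewrite [LHS]/product_measure1.
under eq_integral do rewrite /= step1.
have gd0 x : 0 <= gauss_density a x 0 := gauss_density_ge0 a x 0.
rewrite (ge0_integral_density (mu := mu) (h := fun x => gauss_density a x 0))//;
  [| exact: measurable_gauss_density | by move=> A mA; exact: normal_probE |
   | by move=> x; apply: integral_ge0 => z _; rewrite lee_fin]; last first.
  apply: (@measurable_fun_fubini_tonelli_F _ _ _ _ _ mu (EFin \o F)) => //.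
  exact/measurable_EFinP.
pose H (xz : R * R) := (F xz * gauss_density a xz.1 0)%:E.
transitivity (\int[mu]_x \int[mu]_z H (x, z))%E.
  apply: eq_integral => x _; rewrite -ge0_integralZr//.
  - by apply/measurable_EFinP; exact: (measurable_fun_pair2 x mF).
  - by move=> z _; rewrite lee_fin.
  - by rewrite lee_fin.
have mH : measurable_fun setT H.
  apply/measurable_EFinP; apply: measurable_funM => //.
  exact: measurableT_comp (measurable_gauss_density a) measurable_fst.
have H0 xz : (0 <= H xz)%E by rewrite lee_fin mulr_ge0.
rewrite [LHS](@fubini_tonelli _ _ _ _ _ mu mu H mH H0).
have step2 z : (\int[mu]_x H (x, z) = normal_prob 0 (Num.sqrt v) B *
    (gauss_density (a + b) z 0 * \1_B' z)%:E)%E.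
  rewrite normal_prob_indic// -ge0_integralZr//; last 3 first.
  - apply/measurable_EFinP; apply: measurable_funM => //.
    exact: measurable_gauss_density.
  - by move=> x _; rewrite lee_fin mulr_ge0// gauss_density_ge0.
  - by rewrite lee_fin mulr_ge0// gauss_density_ge0.
  rewrite -[RHS](@ge0_integralD_shift _ (- (c * z))).
  - apply: eq_integral => x _; rewrite /H /F /= -EFinM; congr EFin.
    have mulE (p q r s : R) : p * q * r * s = (s * p) * (q * r) by ring.
    by rewrite mulE gauss_density_mul// [RHS]mulrACA.
  - apply/measurable_EFinP; apply: measurable_funM => //.
    apply: measurable_funM => //.
    exact: measurable_gauss_density.
  - by move=> x; rewrite lee_fin !mulr_ge0// gauss_density_ge0.
under eq_integral do rewrite step2.
rewrite ge0_integralZl//.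
- by rewrite -normal_prob_indic.
- apply/measurable_EFinP; apply: measurable_funM => //.
  exact: measurable_gauss_density.
- by move=> x _; rewrite lee_fin mulr_ge0// gauss_density_ge0.
Qed.

End gaussian.

(** * Brownian bridges *)

Section process_sigma_facts.
Context {d : measure_display} {Omega : measurableType d} {R : realType}.
Implicit Types X : R -> Omega -> R.

Lemma process_sigma_sub X I : (forall s, I s -> measurable_fun setT (X s)) ->
  process_sigma X I `<=` measurable.
Proof.
move=> mX; apply: smallest_sub; first exact: sigma_algebra_measurable.
by move=> A [s Is] [B mB <-]; exact: mX.
Qed.

Lemma process_sigmaS X I J : I `<=` J -> process_sigma X I `<=` process_sigma X J.
Proof.
move=> IJ; apply: sub_sigma_algebra2; apply: bigcup_sub => s Is A XA.
by exists s => //; exact: IJ.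
Qed.

(** The events that depend on finitely many coordinates form a pi-system which
    generates [process_sigma X I]. *)
Lemma process_sigma_indep (P : probability Omega R) X I (G : set (set Omega)) :
  (forall s, I s -> measurable_fun setT (X s)) -> G `<=` measurable ->
  (forall l : seq R, [set` l] `<=` I ->
     indep_systems P (process_sigma X [set` l]) G) ->
  indep_systems P (process_sigma X I) G.
Proof.
move=> mX Gm lG.
pose F := \bigcup_(l in [set l : seq R | [set` l] `<=` I])
  process_sigma X [set` l].
have FX : F `<=` process_sigma X I.
  by move=> A [l lI]; exact: process_sigmaS.
have : indep_systems P <<s F >> G.
  apply: indep_systems_gen => //.
  - move=> A B [l lI Al] [l' l'I Bl']; exists (l ++ l').
      by move=> x /=; rewrite mem_cat => /orP[/lI|/l'I].
    apply: (@measurableI _ (g_sigma_algebraType _)).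
      by apply: process_sigmaS Al => x /=; rewrite mem_cat => ->.
    by apply: process_sigmaS Bl' => x /=; rewrite mem_cat => ->; rewrite orbT.
  - exists [::]; first by move=> x.
    exact: (@measurableT _ (g_sigma_algebraType _)).
  - by move=> A /FX; exact: process_sigma_sub.
  - by move=> A B [l lI Al] GB; exact: lG lI _ _ Al GB.
apply: indep_systemsS => //; apply: sub_sigma_algebra2 => A [s Is XA].
exists [:: s]; first by move=> x; rewrite /= inE => /eqP ->.
by apply: sub_sigma_algebra; exists s => //=; rewrite inE.
Qed.

End process_sigma_facts.

Section gauss_pair.
Context {d : measure_display} {Omega : measurableType d} {R : realType}.
Variable P : probability Omega R.
Local Notation N a := (normal_prob 0 (Num.sqrt a)).

(** The event [E] gathers the other, independent, variables: under the
    restriction of [P] to [E] the pair [(X, Y)] has law [p] times the product of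
    two Gaussian laws. *)
Lemma gauss_pair_rotation (E : set Omega) (X Y : Omega -> R) (a b : R)
    (p : {nonneg R}) : measurable E ->
  measurable_fun setT X -> measurable_fun setT Y -> 0 < a -> 0 < b ->
  (forall B B', measurable B -> measurable B' ->
    P (E `&` [set w | B (X w) /\ B' (Y w)]) = (p%:num%:E * (N a B * N b B'))%E) ->
  forall B B', measurable B -> measurable B' ->
    P (E `&` [set w | B (X w - a / (a + b) * (X w + Y w)) /\ B' (X w + Y w)]) =
    (p%:num%:E * (N (a * b / (a + b)) B * N (a + b) B'))%E.
Proof.
move=> mE mX mY a0 b0 XY B B' mB mB'.
have mXY : measurable_fun setT
    (fun w => (X w, Y w) : measurableTypeR R * measurableTypeR R).
  exact: measurable_fun_pair.
pose D := [set xy : R * R | B (xy.1 - a / (a + b) * (xy.1 + xy.2)) /\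
                            B' (xy.1 + xy.2)].
have mD : measurable D.
  apply: measurableI.
    have h : measurable_fun setT
        (fun xy : R * R => xy.1 - a / (a + b) * (xy.1 + xy.2)).
      apply: measurable_funB => //; apply: measurable_funM => //.
      exact: measurable_funD.
    by rewrite -[X in measurable X]setTI; exact: h.
  have h : measurable_fun setT (fun xy : R * R => xy.1 + xy.2).
    exact: measurable_funD.
  by rewrite -[X in measurable X]setTI; exact: h.
rewrite -gauss_rotation//.
transitivity (image_measure (mrestr P mE) mXY D).
  by rewrite /image_measure/= /pushforward /mrestr setIC.
rewrite -[LHS](@product_measure_unique _ _ _ _ _ (mscale p (N a)) (N b)
  (image_measure (mrestr P mE) mXY))//.
  apply: ge0_integral_mscale => //; exact: measurable_fun_xsection.
move=> A A' mA mA'; rewrite /image_measure/= /pushforward /mrestr setIC.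
by rewrite -[RHS]muleA -XY.
Qed.

End gauss_pair.

Section chain.
Context {d : measure_display} {Omega : measurableType d} {R : realType}.
Variables (P : probability Omega R) (W : R -> Omega -> R).
Hypothesis W_bm : is_brownian_motion P W.
Local Notation N a := (normal_prob 0 (Num.sqrt a)).

Definition bridge (s u : R) (w : Omega) : R := W u w - u / s * W s w.

Lemma measurable_bridge s u : 0 <= s -> 0 <= u ->
  measurable_fun setT (bridge s u).
Proof.
move=> s0 u0; apply: measurable_funB; first exact: (bm_measurable W_bm).
by apply: measurable_funM => //; exact: (bm_measurable W_bm).
Qed.

Variable s : nat -> R.
Hypotheses (s0 : 0 < s 0%N) (sS : forall i, s i < s i.+1).

Let s_gt0 i : 0 < s i.
Proof. by elim: i => // i /lt_trans; apply. Qed.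

Let Z i := bridge (s i.+1) (s i).
Let X i w := W (s i.+1) w - W (s i) w.

Let mW i : measurable_fun setT (W (s i)).
Proof. by apply: (bm_measurable W_bm); rewrite ltW. Qed.

Let mZ i : measurable_fun setT (Z i).
Proof. by apply: measurable_bridge; rewrite ltW. Qed.

Let mX i : measurable_fun setT (X i).
Proof. exact: measurable_funB. Qed.

Let mpre (f : Omega -> R) B : measurable_fun setT f -> measurable B ->
  measurable [set w | B (f w)].
Proof. by move=> mf mB; rewrite -[X in measurable X]setTI; exact: mf. Qed.

Let var i := s i * (s i.+1 - s i) / s i.+1.

(** Induction on [k]. The pair of [W (s k)] and the next increment, which are
    independent of everything else in the event, is turned by
    [gauss_pair_rotation] into the bridge [Z k] and [W (s k.+1)]: one bridge
    more and one increment less. For [k = 0] these are the independent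
    increments, with the time [0] put in front of the chain. *)
Lemma chain_bridges (k n : nat) (B C : nat -> set R) (D : set R) :
  (k <= n)%N ->
  (forall i, measurable (B i)) -> (forall i, measurable (C i)) ->
  measurable D ->
  P (\bigcap_(i in `I_k) [set w | B i (Z i w)] `&`
     [set w | D (W (s k) w)] `&`
     \bigcap_(i in [set i | (k <= i < n)%N]) [set w | C i (X i w)]) =
  ((\prod_(i < k) N (var i) (B i)) * N (s k) D *
    \prod_(k <= i < n) N (s i.+1 - s i)%R (C i))%E.
Proof.
move=> kn mB; elim: k kn C D => [|k IH] kn C D mC mD.
  pose s' i := if i is j.+1 then s j else 0.
  pose C' i := if i is j.+1 then C j else D.
  have s'S i : s' i < s' i.+1 by case: i.
  have mC' i : measurable (C' i) by case: i.
  have := bm_indep_increments W_bm n.+1 (lexx (s' 0%N) : 0 <= s' 0%N) s'S mC'.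
  move=> h.
  transitivity (\prod_(i < n.+1) N (s' i.+1 - s' i)%R (C' i))%E.
    rewrite (eq_bigr (fun i : 'I_n.+1 =>
      P [set w | C' i (W (s' i.+1) w - W (s' i) w)])); last first.
      move=> i _; rewrite (bm_gaussian W_bm)//.
      by case: i => -[|i]//= _; rewrite ltW.
    rewrite -h; congr (P _); apply/seteqP; split => w /=.
      move=> [[_ Dw] Cw] [_|i iS]/=; last exact: Cw.
      by rewrite (bm_start W_bm) subr0.
    move=> h'; split; first split => //.
      by have := h' 0%N isT; rewrite /= (bm_start W_bm) subr0.
    by move=> i /= iS; exact: (h' i.+1).
  by rewrite big_ord0 mul1e big_mkord big_ord_recl/= subr0.
have mule_rot (a b c e : \bar R) : (a * c * e * b = (a * b) * (c * e))%E.
  by rewrite [RHS]muleACA -[LHS]muleA [X in (_ * X)%E]muleC.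
pose E := \bigcap_(i in `I_k) [set w | B i (Z i w)] `&`
  \bigcap_(i in [set i | (k.+1 <= i < n)%N]) [set w | C i (X i w)].
have mE : measurable E.
  by apply: measurableI; apply: bigcap_measurableType => i _; exact: mpre.
pose q := ((\prod_(i < k) N (var i) (B i)) *
  \prod_(k.+1 <= i < n) N (s i.+1 - s i)%R (C i))%E.
have XY F F' : measurable F -> measurable F' ->
    P (E `&` [set w | F (W (s k) w) /\ F' (X k w)]) =
    (q * (N (s k) F * N (s k.+1 - s k)%R F'))%E.
  move=> mF mF'.
  have mC' i : measurable (if i == k then F' else C i) by case: ifP.
  have := IH (ltnW kn) _ _ mC' mF.
  rewrite big_ltn// eqxx.
  rewrite (@eq_big_nat _ _ _ k.+1 n _ (fun i => N (s i.+1 - s i)%R (C i)));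
    last by move=> i /andP[ki _]; rewrite gtn_eqF.
  move=> h; rewrite [RHS](_ : _ = ((\prod_(i < k) N (var i) (B i)) * N (s k) F *
    (N (s k.+1 - s k)%R F' *
     \prod_(k.+1 <= i < n) N (s i.+1 - s i)%R (C i)))%E); last first.
    by rewrite /q muleACA; congr (_ * _)%E; exact: muleC.
  rewrite -h; congr (P _); apply/seteqP; split => w /=.
    move=> [[Bw Cw] [Fw F'w]]; split; first by split.
    move=> i /= /andP[ki iN]; case: eqP => [->//|/eqP ik].
    by apply: Cw; rewrite /= iN ltn_neqAle eq_sym ik ki.
  move=> [[Bw Fw] Cw]; split; first split => //.
    move=> i /= /andP[ki iN]; have := Cw i; rewrite /= iN ltnW// gtn_eqF//.
    exact.
  by split => //; have := Cw k; rewrite /= leqnn kn eqxx; exact.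
have qE : q = P E.
  have := XY _ _ measurableT measurableT.
  rewrite !probability_setT !mule1 => <-; congr (P _).
  by apply/seteqP; split => w /=; [case|move=> ?; split].
have [p pq] : exists p : {nonneg R}, q = (p%:num)%:E.
  have PE0 : 0 <= fine (P E) by rewrite fine_ge0.
  by exists (NngNum PE0); rewrite qE fineK// fin_num_measure.
have d0 : 0 < s k.+1 - s k by rewrite subr_gt0.
rewrite pq in XY.
have := gauss_pair_rotation mE (mW k) (mX k) (s_gt0 k) d0 XY (mB k) mD.
rewrite -pq (addrC (s k)) subrK => h.
rewrite big_ord_recr/= [RHS](_ : _ = (q * (N (var k) (B k) * N (s k.+1) D))%E);
  last first.
  by rewrite /q; exact: mule_rot.
rewrite -h; congr (P _); apply/seteqP.
have XE w : W (s k) w + X k w = W (s k.+1) w by rewrite /X addrC subrK.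
split => w /=; rewrite XE.
  move=> [[Bw Dw] Cw]; split; first split => //.
    by move=> i /= ik; apply: Bw; rewrite /= ltnS ltnW.
  by split => //; exact: (Bw k (ltnSn k)).
move=> [[Bw Cw] [Bk Dw]]; split => //; split => // i /=.
by rewrite ltnS leq_eqVlt => /predU1P[->//|]; exact: Bw.
Qed.

Lemma chain_bridges_indep (n : nat) (B : nat -> set R) :
  (forall i, measurable (B i)) ->
  P (\bigcap_(i in `I_n) [set w | B i (Z i w)]) = (\prod_(i < n) N (var i) (B i))%E.
Proof.
move=> mB; have := chain_bridges (leqnn n) mB mB measurableT.
rewrite big_geq// mule1 probability_setT mule1 => <-.
congr (P _); apply/seteqP; split => w /=; last by case=> -[].
by move=> h; split => // i /=; rewrite ltnNge andbN.
Qed.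

End chain.

Section bridges.
Context {d : measure_display} {Omega : measurableType d} {R : realType}.
Variables (P : probability Omega R) (W : R -> Omega -> R).
Hypothesis W_bm : is_brownian_motion P W.
Local Notation N a := (normal_prob 0 (Num.sqrt a)).
Local Notation bridge := (bridge W).

(** The bridge of length [s n] at the times [s i] is a function of the
    consecutive bridges [Z i = bridge (s i.+1) (s i)] for [i < n], because
    [bridge (s n) (s i) = Z i + s i / s i.+1 * bridge (s n) (s i.+1)]; and these
    are independent of [Z n]. *)
Lemma chain_sigma_indep (s : nat -> R) (n : nat) :
  0 < s 0%N -> (forall i, s i < s i.+1) ->
  indep_systems P
    (process_sigma (bridge (s n)) [set s i | i in `I_n])
    (preimage_set_system setT (bridge (s n.+1) (s n)) measurable).
Proof.
move=> s0 sS.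
have sgt0 i : 0 < s i by elim: i => // i /lt_trans; apply.
pose Z i := bridge (s i.+1) (s i).
have mZ i : measurable_fun setT (Z i) by apply: (measurable_bridge W_bm); rewrite ltW.
have mpre (f : Omega -> R) B : measurable_fun setT f -> measurable B ->
    measurable [set w | B (f w)].
  by move=> mf mB; rewrite -[X in measurable X]setTI; exact: mf.
pose rect (B : nat -> set R) := \bigcap_(i in `I_n) [set w | B i (Z i w)].
pose F := [set rect B | B in [set B | forall i, measurable (B i)]].
pose G := preimage_set_system setT (Z n) measurable.
have FG : indep_systems P <<s F >> G.
  apply: indep_systems_gen.
  - move=> _ _ [B mB <-] [B' mB' <-]; exists (fun i => B i `&` B' i).
      by move=> i; exact: measurableI.
    by rewrite /rect -bigcapI.
  - exists (fun=> setT); first by move=> i; exact: measurableT.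
    by rewrite /rect; apply/seteqP; split.
  - by move=> _ [B mB <-]; apply: bigcap_measurableType => i _; exact: mpre.
  - by move=> _ [B mB <-]; exact: mZ.
  - move=> _ _ [B mB <-] [C mC <-].
    pose B' C i := if i == n then C else B i.
    have rectE D : rect B `&` (setT `&` Z n @^-1` D) =
        \bigcap_(i in `I_n.+1) [set w | B' D i (Z i w)].
      rewrite setTI; apply/seteqP; split => w /=.
        move=> [h hD] i /=; rewrite /B' ltnS leq_eqVlt.
        by case: eqP => [->//|_ /h].
      move=> h; split; last by have := h n (ltnSn n); rewrite /B'/= eqxx.
      move=> i /= iN; have := h i (ltnW iN); rewrite /B'/= ltn_eqF//.
    have B'E D : (\prod_(i < n) N (s i * (s i.+1 - s i) / s i.+1)%R (B' D i) =
      \prod_(i < n) N (s i * (s i.+1 - s i) / s i.+1)%R (B i))%E.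
      by apply: eq_bigr => i _; rewrite /B' ltn_eqF.
    have mB' D : measurable D -> forall i, measurable (B' D i).
      by move=> mD i; rewrite /B'; case: ifP.
    have PE D : measurable D -> P (rect B `&` (setT `&` Z n @^-1` D)) =
        (P (rect B) * N (s n * (s n.+1 - s n) / s n.+1)%R D)%E.
      move=> mD; rewrite rectE (chain_bridges_indep W_bm s0 sS _ (mB' _ mD)).
      rewrite big_ord_recr/= B'E /B' eqxx.
      by rewrite (chain_bridges_indep W_bm s0 sS _ mB).
    rewrite PE//; congr (_ * _)%E.
    have /= := chain_bridges_indep W_bm s0 sS n.+1
      (B := fun i => if i == n then C else setT).
    rewrite big_ord_recr/= eqxx big1 ?mul1e => [<-|i _].
    - congr (P _); rewrite setTI; apply/seteqP; split => w /=.
        by move=> /(_ n (ltnSn n)); rewrite /= eqxx.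
      by move=> h i /= _; case: eqP => // ->.
    - by move=> i; case: ifP.
    - by rewrite ltn_eqF// probability_setT.
apply: indep_systemsS FG => //.
have mZF i : (i < n)%N ->
    measurable_fun (setT : set (g_sigma_algebraType F)) (Z i).
  move=> iN _ B mB; rewrite setTI; apply: sub_sigma_algebra.
  exists (fun j => if j == i then B else setT) => [j|]; first by case: ifP.
  apply/seteqP; split => w /=; first by move=> /(_ i iN)/=; rewrite eqxx.
  by move=> h j /= _; case: eqP => // ->.
have mbr j : (j <= n)%N ->
    measurable_fun (setT : set (g_sigma_algebraType F)) (bridge (s n) (s (n - j)%N)).
  elim: j => [_|j IH jn].
    rewrite subn0 (_ : bridge _ _ = cst 0); first exact: measurable_cst.
    by apply/funext => w; rewrite /bridge divff ?gt_eqF// mul1r subrr.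
  have nj : (n - j = (n - j.+1).+1)%N by rewrite subnSK.
  have := IH (ltnW jn); rewrite nj => {}IH; set i := (n - j.+1)%N in IH *.
  rewrite (_ : bridge _ _ = (fun w => Z i w + s i / s i.+1 * bridge (s n) (s i.+1) w)).
    apply: measurable_funD; last exact: measurable_funM.
    by apply: mZF; rewrite /i ltn_subrL (leq_ltn_trans _ jn).
  apply/funext => w; rewrite /Z /bridge; field.
  by rewrite !gt_eqF.
apply: smallest_sub.
  by have [] := @smallest_sigma_algebra _ setT F; split.
move=> A [_ [i /= iN <-]] [B mB <-].
by have := mbr (n - i)%N (leq_subr _ _); rewrite subKn ?(ltnW iN)//; exact.
Qed.

(** Finitely many times of [ ]0, s[ ] suffice. Once sorted, and followed by [s]
    and [r], they start a chain to which [chain_sigma_indep] applies. *)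
Lemma bridge_past_indep (s r : R) : 0 < s -> s < r ->
  indep_systems P (process_sigma (bridge s) `]0, s[)
                  (preimage_set_system setT (bridge r s) measurable).
Proof.
move=> s0 sr.
have r0 : 0 < r by exact: lt_trans sr.
apply: process_sigma_indep => [u| |l lI].
- by rewrite /= in_itv/= => /andP[/ltW u0 _]; apply: (measurable_bridge W_bm);
    rewrite // ltW.
- by move=> _ [B mB <-]; apply: (measurable_bridge W_bm); rewrite // ltW.
pose q := sort <=%R (undup l).
have qs : sorted <%R q.
  rewrite lt_sorted_uniq_le sort_uniq undup_uniq.
  exact: (sort_sorted le_total).
have qE u : (u \in q) = (u \in l) by rewrite mem_sort mem_undup.
pose n := size q.
(* The sorted times, then [s] and [r], continued past [r] by unit steps. *)
pose c i := if (i < n)%N then nth 0 q i else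
  if i == n then s else r + (i - n.+1)%:R.
have cI i : (i < n)%N -> 0 < c i < s.
  move=> iN; rewrite /c iN; have := @mem_nth _ 0 q i iN.
  by rewrite qE => /lI; rewrite /= in_itv.
have cn : c n = s by rewrite /c ltnn eqxx.
have cSn : c n.+1 = r.
  by rewrite /c ltnNge leqnSn/= gtn_eqF// subnn addr0.
have c0 : 0 < c 0%N.
  have [n0|n0] := posnP n; first by rewrite -n0 cn.
  by have /andP[] := cI 0%N n0.
have cS i : c i < c i.+1.
  have [iN|Ni|->] := ltngtP i n; last by rewrite cn cSn.
    have [Si|Si] := eqVneq i.+1 n.
      by rewrite Si cn; have /andP[] := cI _ iN.
    have SiN : (i.+1 < n)%N by rewrite ltn_neqAle Si.
    rewrite /c iN SiN; apply: (sorted_ltn_nth lt_trans) => //=.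
  rewrite /c (ltnNge i) (ltnW Ni)/= (gtn_eqF Ni) (ltnNge i.+1).
  rewrite (leq_trans (ltnW Ni) (leqnSn i))/= gtn_eqF ?ltnS ?(ltnW Ni)//.
  by rewrite ltrD2l ltr_nat subSn.
have := @chain_sigma_indep c n c0 cS; rewrite cn cSn.
apply: indep_systemsS => //; apply: process_sigmaS => u /= ul.
have uq : u \in q by rewrite qE.
exists (index u q); first by rewrite /= index_mem.
by rewrite /c index_mem uq nth_index.
Qed.

Lemma bridge_normal (s r : R) (B : set R) : 0 < s -> s < r -> measurable B ->
  P [set w | B (bridge r s w)] = N (s * (r - s) / r) B.
Proof.
move=> s0 sr mB.
pose c i := if i == 0%N then s else r + i.-1%:R.
have c0 : 0 < c 0%N by [].
have cS i : c i < c i.+1.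
  by case: i => [|i]; rewrite /c/= ?addr0// ltrD2l ltr_nat.
have := chain_bridges_indep W_bm c0 cS 1 (fun=> mB).
rewrite big_ord_recl big_ord0 mule1/=.
have cr : c 1%N = r by rewrite /c addr0.
rewrite cr => <-; congr (P _); apply/seteqP; split => w /=.
  by move=> h i /=; rewrite ltnS leqn0 => /eqP ->; rewrite cr.
by move=> /(_ 0%N isT); rewrite cr.
Qed.

End bridges.

(** * The default time and the information process *)

(** With [0^-1 = 0], the inverse is the difference of the inverses of the
    positive and negative parts, each of which is a power function. *)
Lemma measurable_inv {R : realType} : measurable_fun setT (@GRing.inv R).
Proof.
have pos : measurable_fun setT (fun x : R => (Num.max x 0)^-1).
  rewrite (_ : (fun _ => _) = (fun x : R => Num.max x 0 `^ (-1))); last first.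
    by apply/funext => x; rewrite powR_inv1// le_max lexx orbT.
  have mm : measurable_fun setT (fun x : R => Num.max x 0).
    by apply: measurable_maxr.
  exact: measurableT_comp (@measurable_powR R (-1)) mm.
rewrite (_ : GRing.inv = fun x : R => (Num.max x 0)^-1 - (Num.max (- x) 0)^-1).
  apply: measurable_funB => //.
  exact: (measurableT_comp pos (@oppr_measurable R setT)).
apply/funext => x; have [x0|x0|->] := ltgtP x 0.
- rewrite max_l ?oppr_ge0 ?(ltW x0)//.
  by rewrite invr0 sub0r invrN opprK.
- by rewrite max_r ?oppr_le0 ?(ltW x0)// invr0 subr0.
- by rewrite oppr0 maxxx invr0 subr0.
Qed.

Lemma measurable_funV {d} {T : measurableType d} {R : realType} (f : T -> R) :
  measurable_fun setT f -> measurable_fun setT (fun x => (f x)^-1).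
Proof. exact: measurableT_comp measurable_inv. Qed.

Section joint_measurability.
Context {d : measure_display} {Omega : measurableType d} {R : realType}.
Variables (P : probability Omega R) (W : R -> Omega -> R).
Hypothesis W_bm : is_brownian_motion P W.

Definition path_generators : set (set Omega) :=
  \bigcup_(s in `[0, +oo[) preimage_set_system setT (W s) measurable.

Local Notation OW := (g_sigma_algebraType path_generators).

Lemma path_generators_sub : <<s path_generators >> `<=` measurable.
Proof.
apply: process_sigma_sub => s; rewrite /= in_itv/= andbT.
exact: (bm_measurable W_bm).
Qed.

Lemma path_cvg (u : R^nat) (t : R) w : (forall n, 0 <= u n) -> 0 <= t ->
  u n @[n --> \oo] --> t -> W (u n) w @[n --> \oo] --> W t w.
Proof.
move=> u0 t0 ut.
have /subspace_continuousP/(_ t) := @bm_continuous _ _ _ _ _ W_bm w.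
rewrite /= in_itv/= andbT => /(_ t0) Wt.
have ut' : u n @[n --> \oo] --> within `[0, +oo[ (nbhs t).
  move=> A At.
  have h : \forall n \near \oo, `[0, +oo[%classic (u n) -> A (u n) := ut _ At.
  suff : \forall n \near \oo, A (u n) by [].
  by apply: filterS h => n; apply; rewrite /= in_itv/= u0.
exact: (cvg_comp _ _ ut' Wt).
Qed.

(** The right endpoints of a grid of mesh [1 / n] give approximations of the time
    for which [W] is jointly measurable, being a countable case distinction;
    they converge by continuity of the paths. Negative times are sent to [0]. *)
Lemma measurable_path_joint :
  measurable_fun (setT : set (R * OW)) (fun rw => W (Num.max rw.1 0) rw.2).
Proof.
pose x (n : nat) (r : R) := n.+1%:R * Num.max r 0.
pose f n (rw : R * OW) := W ((Num.truncn (x n rw.1)).+1%:R / n.+1%:R) rw.2.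
have x0 n r : 0 <= x n r by rewrite mulr_ge0// le_max lexx orbT.
have mx n : measurable_fun setT (x n).
  by apply: measurable_funM => //; exact: measurable_maxr.
apply: (@measurable_fun_cvg _ _ _ _ f) => [n|rw _].
- move=> _ B mB; rewrite setTI.
  rewrite (_ : _ @^-1` B = \bigcup_k ((x n @^-1` `[k%:R, k.+1%:R[) `*`
      (W (k.+1%:R / n.+1%:R) @^-1` B : set OW))).
    apply: bigcupT_measurable => k; apply: measurableX.
      by rewrite -[X in measurable X]setTI; exact: mx.
    apply: sub_sigma_algebra; exists (k.+1%:R / n.+1%:R).
      by rewrite /= in_itv/= divr_ge0.
    by exists B => //; rewrite setTI.
  apply/seteqP; split => -[r w] /=.
    move=> Bw; exists (Num.truncn (x n r)) => //; split => //=.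
    by rewrite in_itv/= truncn_itv.
  by move=> [k _ [/=]]; rewrite in_itv/= /f/= => /truncn_def ->.
- apply: path_cvg; [by move=> n; rewrite divr_ge0| |].
    by rewrite le_max lexx orbT.
  set t := Num.max rw.1 0.
  have le_t n : t <= (Num.truncn (x n rw.1)).+1%:R / n.+1%:R <= t + n.+1%:R^-1.
    have /andP[h1 h2] := truncn_itv (x0 n rw.1).
    rewrite ler_pdivlMr// mulrC (ltW h2)/= ler_pdivrMr// mulrDl mulVf//.
    by rewrite -natr1 lerD2r mulrC.
  apply: (squeeze_cvgr (f := cst t) (h := fun n => t + n.+1%:R^-1)).
  + by apply: nearW => n; exact: le_t.
  + exact: cvg_cst.
  + rewrite -[X in _ --> X]addr0; apply: cvgD; first exact: cvg_cst.
    exact: cvg_harmonic.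
Qed.

End joint_measurability.

Section default_time.
Context {d : measure_display} {Omega : measurableType d} {R : realType}.
Variables (P : probability Omega R) (W : R -> Omega -> R).
Hypothesis W_bm : is_brownian_motion P W.
Variable tau : {RV P >-> R}.
Hypothesis tau_indep : independent_of_process P tau W.
Local Notation N a := (normal_prob 0 (Num.sqrt a)).
Local Notation OW := (g_sigma_algebraType (path_generators W)).
Local Notation beta := (information_process W tau).
Local Notation TR := (measurableTypeR R).

Lemma measurable_default_time : measurable_fun setT (tau : Omega -> TR).
Proof. by have h := measurable_funPT tau; exact: h. Qed.

Definition default_law : {finite_measure set TR -> \bar R} :=
  image_measure P measurable_default_time.

Definition path_law : {finite_measure set OW -> \bar R} :=
  sub_measure (path_generators_sub W_bm) P.

Let mpair : measurable_fun setT (fun w => (tau w, w) : TR * OW).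
Proof.
apply: measurable_fun_pair; first exact: measurable_default_time.
exact: (measurable_id_sub (path_generators_sub W_bm)).
Qed.

(** Independence says that the law of the pair formed by the default time and the
    path is a product; the path is represented by [w] itself, with the
    sigma-algebra that [W] generates. *)
Lemma joint_law (D : set (TR * OW)) : measurable D ->
  P [set w | D (tau w, w)] = (default_law \x path_law)%E D.
Proof.
move=> mD; rewrite [RHS](@product_measure_unique _ _ _ _ _ default_law path_law
  (image_measure P mpair))// => A B mA mB.
transitivity (P (tau @^-1` A `&` B)) => //.
by rewrite tau_indep//; exists A => //; rewrite setTI.
Qed.

Lemma measurable_frozen_information (s : R) : 0 <= s ->
  measurable_fun (setT : set (TR * OW)) (fun rw =>
    W s rw.2 - s / Num.max rw.1 s * W (Num.max rw.1 s) rw.2).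
Proof.
move=> s0.
have mmax : measurable_fun (setT : set (TR * OW)) (fun rw => Num.max rw.1 s).
  exact: measurable_maxr.
apply: measurable_funB.
  apply: (measurableT_comp (f := (W s : OW -> R))); last exact: measurable_snd.
  move=> _ B mB; apply: sub_sigma_algebra; exists s; last by exists B.
  by rewrite /= in_itv/= s0.
apply: measurable_funM.
  by apply: measurable_funM => //; exact: measurable_funV.
rewrite (_ : (fun _ => _) = (fun rw : R * OW => W (Num.max rw.1 0) rw.2) \o
  (fun rw : TR * OW => (Num.max rw.1 s, rw.2) : R * OW)); last first.
  apply/funext => rw /=.
  have h : 0 <= Num.max rw.1 s by rewrite le_max s0 orbT.
  by rewrite [Num.max _ 0]max_l.
apply: measurableT_comp; first exact: (measurable_path_joint W_bm).
exact: measurable_fun_pair.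
Qed.

Lemma measurable_information_process (s : R) : 0 <= s ->
  measurable_fun setT (beta s).
Proof. by move=> s0; exact: measurableT_comp (measurable_frozen_information s0) mpair. Qed.

End default_time.

Section bridge_density_facts.
Context {R : realType}.
Local Notation TR := (measurableTypeR R).

Lemma bridge_density_ge0 (t r x : R) : 0 <= bridge_density t r x.
Proof. by rewrite /bridge_density; case: ifP => // _; exact: gauss_density_ge0. Qed.

Lemma bridge_density0 (t r x : R) : r <= t -> bridge_density t r x = 0.
Proof. by rewrite /bridge_density leNgt => /negbTE ->; rewrite andbF. Qed.

Lemma measurable_bridge_density (t : R) : 0 < t ->
  measurable_fun (setT : set (TR * TR))
    (fun rx => bridge_density t rx.1 rx.2).
Proof.
move=> t0.
have m1 : measurable_fun (setT : set (TR * TR)) (fun rx : TR * TR => rx.1 : R).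
  exact: measurable_fst.
have m2 : measurable_fun (setT : set (TR * TR)) (fun rx : TR * TR => rx.2 : R).
  exact: measurable_snd.
have mv : measurable_fun (setT : set (TR * TR))
    (fun rx : TR * TR => t * (rx.1 - t) / rx.1 : R).
  apply: measurable_funM; last exact: measurable_funV.
  by apply: measurable_funM => //; exact: measurable_funB.
rewrite (_ : (fun _ => _) = fun rx : TR * TR => \1_(`]t, +oo[%classic) (rx.1 : R) *
    gauss_density (t * (rx.1 - t) / rx.1) rx.2 0).
  apply: measurable_funM; first exact: measurable_indic_comp.
  apply: measurable_funM.
    apply: measurable_funV.
    have msqrt : measurable_fun setT (@Num.sqrt R).
      by apply: continuous_measurable_fun; exact: sqrt_continuous.
    by apply: (measurableT_comp msqrt); exact: measurable_funM.
  apply: measurableT_comp => //; apply: measurable_funM.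
    apply: measurableT_comp => //.
    by apply: measurable_funX; exact: measurable_funB.
  by apply: measurable_funV; exact: measurable_funM.
apply/funext => rx; rewrite /bridge_density t0/= indicE.
have -> : (rx.1 \in `]t, +oo[%classic) = (t < rx.1).
  by apply/idP/idP; rewrite inE/= in_itv/= andbT.
by case: ltP => _; rewrite ?mul1r ?mul0r.
Qed.

(** A centred Gaussian density at [x] is at most of order [1 / `|x|], whatever the
    variance. This bound, uniform in the default time [r] and in [t], dominates
    all the limits below. *)
Lemma bridge_density_le (t r x : R) : x != 0 -> bridge_density t r x <= `|x|^-1.
Proof.
move=> x0; rewrite /bridge_density; case: ifPn => [/andP[t0 tr]|_]; last first.
  by rewrite invr_ge0.
have r0 : 0 < r by exact: lt_trans tr.
set a := t * (r - t) / r.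
have a0 : 0 < a by rewrite divr_gt0// mulr_gt0// subr_gt0.
have xn0 : 0 < `|x| by rewrite normr_gt0.
rewrite -[leRHS]mul1r ler_pdivlMr//.
rewrite -(@expr_le1 _ 2)// ?mulr_ge0 ?gauss_density_ge0//.
rewrite /gauss_density subr0 !exprMn -normrX ger0_norm ?sqr_ge0//.
have pia : 0 <= 2 * pi * a.
  by apply: mulr_ge0 (ltW a0); apply: mulr_ge0 => //; exact: pi_ge0.
rewrite exprVn (sqr_sqrtr pia).
rewrite mulNr.
set y := x ^+ 2 / (2 * a).
have y0 : 0 <= y by rewrite divr_ge0 ?sqr_ge0// mulr_ge0// ltW.
have e0 : 0 <= expR (- y) by exact: expR_ge0.
have e1 : expR (- y) <= 1 by rewrite -expR0 ler_expR oppr_le0.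
have ye : expR (- y) * y <= 1.
  rewrite expRN mulrC ler_pdivrMr ?expR_gt0// mul1r.
  by apply: le_trans (expR_ge1Dx y); rewrite lerDr.
have pi1 : (pi : R)^-1 <= 1.
  by rewrite invf_le1 ?pi_gt0// (le_trans _ (pi_ge2 _))// ler1n.
have -> : (2 * pi * a)^-1 * expR (- y) ^+ 2 * x ^+ 2 =
    pi^-1 * (expR (- y) * (expR (- y) * y)).
  have key (p e : R) : p != 0 -> (2 * p * a)^-1 * e ^+ 2 * x ^+ 2 =
      p^-1 * (e * (e * (x ^+ 2 / (2 * a)))).
    by move=> p0; field; rewrite p0 gt_eqF.
  by apply: key; rewrite gt_eqF// pi_gt0.
have ye0 : 0 <= expR (- y) * y by rewrite mulr_ge0.
have pi0 : 0 <= (pi : R)^-1 by rewrite invr_ge0 pi_ge0.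
have eye0 : 0 <= expR (- y) * (expR (- y) * y) by rewrite mulr_ge0.
have eye1 : expR (- y) * (expR (- y) * y) <= 1 by exact: mulr_ile1.
exact: mulr_ile1.
Qed.

End bridge_density_facts.

Section default_information.
Context {d : measure_display} {Omega : measurableType d} {R : realType}.
Variables (P : probability Omega R) (W : R -> Omega -> R).
Hypothesis W_bm : is_brownian_motion P W.
Variable tau : {RV P >-> R}.
Hypothesis tau_indep : independent_of_process P tau W.
Local Notation N a := (normal_prob 0 (Num.sqrt a)).
Local Notation OW := (g_sigma_algebraType (path_generators W)).
Local Notation beta := (information_process W tau).
Local Notation TR := (measurableTypeR R).
Local Notation law := (default_law tau).

(** The information process at time [s] when the default time is frozen at [r]. *)
Let info (s r : R) (w : Omega) : R :=
  W s w - s / Num.max r s * W (Num.max r s) w.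

Let info_bridge (s r : R) : s < r -> info s r = bridge W r s.
Proof. by move=> sr; apply/funext => w; rewrite /info max_l// ltW. Qed.

Let info_after (s r : R) : 0 < s -> r <= s -> info s r = cst 0.
Proof.
by move=> s0 rs; apply/funext => w; rewrite /info max_r// divff ?gt_eqF// mul1r subrr.
Qed.

Lemma bridge_sigma_path (s : R) : 0 < s ->
  process_sigma (bridge W s) `]0, s[ `<=` <<s path_generators W >>.
Proof.
move=> s0; have mW u : 0 <= u -> measurable_fun (setT : set OW) (W u).
  move=> u0 _ B mB; apply: sub_sigma_algebra; exists u; last by exists B.
  by rewrite /= in_itv/= u0.
apply: smallest_sub; first exact: (@sigma_algebra_measurable _ OW).
move=> A [u]; rewrite /= in_itv/= => /andP[u0 us] [B mB <-].
have : measurable_fun (setT : set OW) (bridge W s u).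
  apply: measurable_funB; first by apply: mW; exact: ltW.
  by apply: measurable_funM => //; apply: mW; exact: ltW.
exact.
Qed.

Let event (s : R) (C B : set R) (I : set Omega) : set (TR * OW) :=
  [set rw | C rw.1 /\ I rw.2 /\ B (info s rw.1 rw.2)].

Let mevent (s : R) C B I : 0 < s -> measurable C -> measurable B ->
  <<s path_generators W >> I -> measurable (event s C B I).
Proof.
move=> s0 mC mB GI; apply: measurableI.
  by rewrite -[X in measurable X]setTI; exact: measurable_fst.
apply: measurableI.
  by rewrite -[X in measurable X]setTI; exact: measurable_snd.
have := measurable_frozen_information W_bm (ltW s0) measurableT mB.
by rewrite setTI.
Qed.

Let P_event (s : R) C B I : 0 < s -> measurable C -> measurable B ->
  <<s path_generators W >> I ->
  P (I `&` [set w | C (tau w) /\ B (beta s w)]) =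
  (\int[law]_(r in C) P (I `&` [set w | B (info s r w)]))%E.
Proof.
move=> s0 mC mB GI.
transitivity ((law \x path_law W_bm)%E (event s C B I)).
  rewrite -joint_law//; last exact: mevent.
  by congr (P _); apply/seteqP; split => w /=; rewrite /event/=; tauto.
rewrite /product_measure1 [RHS]integral_mkcond.
apply: eq_integral => r _; rewrite patchE; case: ifPn => [/set_mem Cr|Cr].
  congr (P _); apply/seteqP; split => w /=; rewrite /xsection/= inE.
    by move=> [_ []].
  by move=> [Iw Bw]; split.
rewrite /= (_ : xsection _ _ = set0) ?measure0//.
apply/seteqP; split => w //=; rewrite /xsection/= inE => -[Cr' _].
by move: Cr; rewrite notin_setE.
Qed.

(** Given [tau = r], [beta s] is the bridge of length [r] at time [s] if [s < r],
    and [0] otherwise; both are independent of the bridge of length [s]. *)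
Lemma past_default_indep (s : R) (I : set Omega) (C B : set R) : 0 < s ->
  process_sigma (bridge W s) `]0, s[ I -> measurable C -> measurable B ->
  P (I `&` [set w | C (tau w) /\ B (beta s w)]) =
  (P I * P [set w | C (tau w) /\ B (beta s w)])%E.
Proof.
move=> s0 sI mC mB.
have GI := bridge_sigma_path s0 sI.
have GT : <<s path_generators W >> setT by exact: (@measurableT _ OW).
have mI := path_generators_sub W_bm GI.
rewrite P_event// -[X in (_ * P X)%E]setTI P_event//.
rewrite -[P I]fineK ?fin_num_measure// -ge0_integralZl_EFin//; last 2 first.
- have := measurable_fun_xsection (path_law W_bm)
    (mevent s0 measurableT mB GT).
  move=> mX; apply: (measurable_funS measurableT (@subsetT _ C)).
  move: mX; rewrite (_ : (fun _ => _) = path_law W_bm \o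
    xsection (event s setT B setT))//.
  apply/funext => r; congr (P _); apply/seteqP.
  by split => w /=; rewrite /xsection/= inE /event/=; tauto.
- by rewrite fine_ge0.
apply: eq_integral => r _; rewrite fineK ?fin_num_measure// setTI.
have [rs|sr] := leP r s.
  rewrite info_after//; have [B0|B0] := pselect (B 0).
    rewrite (_ : [set w | _] = setT) ?setIT ?probability_setT ?mule1//.
    by apply/seteqP; split.
  rewrite (_ : [set w | _] = set0) ?setI0 ?measure0 ?mule0//.
  by apply/seteqP; split.
rewrite info_bridge//; apply: (bridge_past_indep W_bm s0 sr) => //.
by exists B => //; rewrite setTI.
Qed.

(** Given [tau = r > s], [beta s] is the bridge of length [r] at time [s], which by
    [bridge_normal] has density [bridge_density s r]. *)
Lemma default_information_law (s : R) (C B : set R) : 0 < s ->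
  measurable C -> C `<=` `]s, +oo[ -> measurable B ->
  P [set w | C (tau w) /\ B (beta s w)] =
  (\int[lebesgue_measure]_(x in B) \int[law]_(r in C) (bridge_density s r x)%:E)%E.
Proof.
move=> s0 mC Cs mB.
have GT : <<s path_generators W >> setT by exact: (@measurableT _ OW).
rewrite -[X in P X]setTI P_event//.
pose f (rx : TR * TR) := (bridge_density s rx.1 rx.2 * \1_C rx.1 * \1_B rx.2)%:E.
transitivity (\int[law]_r \int[lebesgue_measure]_x f (r, x))%E.
  rewrite integral_mkcond; apply: eq_integral => r _.
  rewrite patchE; case: ifPn => [Cr|Cr]; last first.
    rewrite integral0_eq// => x _.
    by rewrite /f/= indicE (negbTE Cr) mulr0 mul0r.
  have /= := Cs _ (set_mem Cr); rewrite in_itv/= andbT => sr.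
  rewrite setTI info_bridge// bridge_normal//.
  have r0 : 0 < r by exact: lt_trans sr.
  have rs0 : 0 < r - s by rewrite subr_gt0.
  have v0 : 0 < s * (r - s) / r by rewrite divr_gt0// mulr_gt0.
  rewrite normal_prob_indic//; apply: eq_integral => x _.
  by rewrite /f/= [\1_C _]indicE Cr mulr1 /bridge_density s0 sr.
have mf : measurable_fun setT f.
  apply/measurable_EFinP; apply: measurable_funM.
    apply: measurable_funM; first exact: measurable_bridge_density.
    exact: measurable_indic_comp.
  exact: measurable_indic_comp.
have f0 rx : (0 <= f rx)%E.
  by rewrite lee_fin !mulr_ge0// bridge_density_ge0.
rewrite [LHS](@fubini_tonelli _ _ _ _ _ law lebesgue_measure f mf f0).
rewrite [RHS]integral_mkcond; apply: eq_integral => x _.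
rewrite patchE; case: ifPn => Bx; last first.
  by rewrite integral0_eq// => r _; rewrite /f/= [\1_B _]indicE (negbTE Bx) mulr0.
rewrite [RHS]integral_mkcond; apply: eq_integral => r _.
rewrite patchE /f/= [\1_B _]indicE Bx mulr1 indicE.
by case: ifPn => _; rewrite ?mulr1 ?mulr0.
Qed.

End default_information.

(** * The posterior law of the default time *)

Section default_cdf_measure.
Context {d : measure_display} {Omega : measurableType d} {R : realType}.
Variables (P : probability Omega R) (tau : {RV P >-> R}).
Local Notation law := (default_law tau).
Local Notation TR := (measurableTypeR R).

Lemma default_cdf_measure (A : set TR) : measurable A ->
  lebesgue_stieltjes_measure (default_cdf tau) A = law A.
Proof.
apply: lebesgue_stieltjes_measure_unique => _ [[a b]]/= _ <-.
rewrite /lebesgue_stieltjes_measure /measure_extension/=.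
rewrite measurable_mu_extE/=; last exact: is_ocitv.
have [ab|ba] := leP a b; last first.
  by rewrite set_itv_ge ?wlength0 ?measure0// bnd_simp -leNgt ltW.
rewrite wlength_itv_bnd// EFinB /default_cdf !fineK ?fin_num_measure//.
have -> : `]a, b]%classic = `]-oo, b] `\` `]-oo, a] :> set R.
  by rewrite -[RHS]setCK setCD setCitvl setUC -[LHS]setCK setCitv.
rewrite measureD ?setIidr//.
- by move=> w; apply: subset_itvl; rewrite bnd_simp.
- by rewrite -[X in measurable X]setTI; exact: measurable_funPT.
- by rewrite -[X in measurable X]setTI; exact: measurable_funPT.
- apply: (@le_lt_trans _ _ 1%E); last exact: ltry.
  apply: probability_le1.
  by rewrite -[X in measurable X]setTI; exact: measurable_funPT.
Qed.

Lemma default_cdf_integral (D : set TR) (f : TR -> \bar R) :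
  (\int[lebesgue_stieltjes_measure (default_cdf tau)]_(x in D) f x =
   \int[law]_(x in D) f x)%E.
Proof. by apply: eq_measure_integral => A mA _; exact: default_cdf_measure. Qed.

End default_cdf_measure.

Section posterior.
Context {d : measure_display} {Omega : measurableType d} {R : realType}.
Variables (P : probability Omega R) (tau : {RV P >-> R}).
Local Notation law := (default_law tau).
Local Notation TR := (measurableTypeR R).
Local Notation mu := (@lebesgue_measure R).

(** The numerator of the formula of Bayes: the posterior mass of [ ]u, +oo[ ] when
    [beta s = x], before normalization. *)
Definition bridge_mass (s u x : R) : \bar R :=
  (\int[law]_(r in `]u, +oo[) (bridge_density s r x)%:E)%E.

(** The conditional survival function, as a function of the observed value
    [x = beta s w]. *)
Definition posterior_tail (s u x : R) : R :=
  fine (bridge_mass s u x) / fine (bridge_mass s s x).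

Lemma bridge_mass_ge0 s u x : (0 <= bridge_mass s u x)%E.
Proof.
by apply: integral_ge0 => r _; rewrite lee_fin bridge_density_ge0.
Qed.

Let mbd s x : 0 < s -> measurable_fun setT (fun r : TR => bridge_density s r x).
Proof. by move=> s0; exact: (measurable_fun_pair1 x (measurable_bridge_density s0)). Qed.

(** At [x = 0] the masses may be infinite. Both sides are then [0], because
    [fine +oo = 0] and [0^-1 = 0]. *)
Lemma posterior_survivalE (beta : R -> Omega -> R) (s u : R) (w : Omega) :
  0 < s -> posterior_survival tau beta s u w = posterior_tail s u (beta s w).
Proof.
move=> s0; rewrite /posterior_survival /Rintegral default_cdf_integral.
set x := beta s w; rewrite /posterior_density /Rintegral.
rewrite default_cdf_integral -/(bridge_mass s s x).
have c0 : 0 <= (fine (bridge_mass s s x))^-1.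
  by rewrite invr_ge0 fine_ge0// bridge_mass_ge0.
under eq_integral do rewrite EFinM.
rewrite ge0_integralZr//; last 2 first.
- by apply/measurable_EFinP; exact: measurable_funTS (mbd _ s0).
- by move=> r _; rewrite lee_fin bridge_density_ge0.
rewrite -/(bridge_mass s u x) /posterior_tail.
have := bridge_mass_ge0 s u x; case: (bridge_mass s u x) => [m| |]//= _.
move: c0; rewrite le_eqVlt => /predU1P[<-|c0]; first by rewrite mule0 mul0r.
by rewrite gt0_mulye ?lte_fin// mul0r.
Qed.

Lemma bridge_mass_max s u x :
  (\int[law]_(r in `](Num.max u s), +oo[) (bridge_density s r x)%:E)%E =
  bridge_mass s u x.
Proof.
rewrite /bridge_mass integral_mkcond [RHS]integral_mkcond.
apply: eq_integral => r _; rewrite !patchE.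
have mE a : (r \in `]a, +oo[%classic) = (a < r).
  by apply/idP/idP; rewrite inE/= in_itv/= andbT.
rewrite !mE gt_max; case: ltP => //= _; case: ltP => //= rs.
by rewrite bridge_density0.
Qed.

Lemma bridge_mass_le s u x : 0 < s -> (bridge_mass s u x <= bridge_mass s s x)%E.
Proof.
move=> s0; rewrite -[leLHS]bridge_mass_max; apply: ge0_subset_integral => //.
- by apply/measurable_EFinP; exact: measurable_funTS (mbd _ s0).
- by move=> r _; rewrite lee_fin bridge_density_ge0.
- by move=> r /=; rewrite !in_itv/= !andbT gt_max => /andP[].
Qed.

(** At [x = 0] this may fail: the density [bridge_density s r 0] explodes as [r]
    decreases to [s]. *)
Lemma bridge_mass_fin_num s u x : 0 < s -> x != 0 ->
  bridge_mass s u x \is a fin_num.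
Proof.
move=> s0 x0; rewrite ge0_fin_numE ?bridge_mass_ge0//.
apply: (@le_lt_trans _ _ (\int[law]_(r in `]u, +oo[) (`|x|^-1)%:E)%E).
  apply: ge0_le_integral => //.
  - by move=> r _; rewrite lee_fin bridge_density_ge0.
  - by apply/measurable_EFinP; exact: measurable_funTS (mbd _ s0).
  - by move=> r _; rewrite lee_fin bridge_density_le.
rewrite integral_cst// -ge0_fin_numE; last by rewrite mule_ge0// lee_fin.
by rewrite fin_numM// fin_num_measure.
Qed.

Lemma posterior_tail_ge0 s u x : 0 <= posterior_tail s u x.
Proof. by rewrite divr_ge0 ?fine_ge0 ?bridge_mass_ge0. Qed.

Lemma posterior_tail_le1 s u x : 0 < s -> posterior_tail s u x <= 1.
Proof.
move=> s0; rewrite /posterior_tail.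
have := bridge_mass_le u x s0; have := bridge_mass_ge0 s u x.
case: (bridge_mass s s x) => [m| |] /=; last 2 first.
- by rewrite invr0 mulr0.
- by rewrite invr0 mulr0.
case: (bridge_mass s u x) => [n| |] //; rewrite !lee_fin/= => n0 nm.
have := le_trans n0 nm; rewrite le_eqVlt => /predU1P[<-|m0].
  by rewrite invr0 mulr0.
by rewrite ler_pdivrMr// mul1r.
Qed.

Lemma measurable_bridge_mass s u : 0 < s ->
  measurable_fun setT (bridge_mass s u).
Proof.
move=> s0; pose f (rx : TR * TR) := (bridge_density s rx.1 rx.2 *
  \1_(`]u, +oo[%classic : set TR) rx.1)%:E.
have mf : measurable_fun setT f.
  apply/measurable_EFinP; apply: measurable_funM.
    exact: measurable_bridge_density.
  exact: measurable_indic_comp.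
have f0 rx : (0 <= f rx)%E by rewrite lee_fin mulr_ge0// bridge_density_ge0.
rewrite (_ : bridge_mass s u = fubini_G law f).
  exact: measurable_fun_fubini_tonelli_G.
apply/funext => x; rewrite /fubini_G /bridge_mass [LHS]integral_mkcond.
apply: eq_integral => r _; rewrite patchE /f/= indicE.
by case: ifPn => _; rewrite ?mulr1 ?mulr0.
Qed.

Lemma measurable_posterior_tail s u : 0 < s ->
  measurable_fun setT (posterior_tail s u).
Proof.
move=> s0; have mfine v : measurable_fun setT (fun x => fine (bridge_mass s v x)).
  apply: (measurableT_comp (f := @fine R)); first exact: fine_measurable.
  exact: measurable_bridge_mass.
by apply: measurable_funM => //; exact: measurable_funV.
Qed.

Lemma integral_fine_bridge_mass s u (B : set R) : 0 < s -> measurable B ->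
  (\int[mu]_(x in B) (fine (bridge_mass s u x))%:E =
   \int[mu]_(x in B) bridge_mass s u x)%E.
Proof.
move=> s0 mB; apply: ge0_ae_eq_integral => //.
- apply/measurable_EFinP; apply: measurable_funTS.
  apply: (measurableT_comp (f := @fine R)); first exact: fine_measurable.
  exact: measurable_bridge_mass.
- by apply: measurable_funTS; exact: measurable_bridge_mass.
- by move=> x _; rewrite lee_fin fine_ge0// bridge_mass_ge0.
- by move=> x _; exact: bridge_mass_ge0.
- exists [set 0]; split => //; first exact: lebesgue_measure_set1.
  move=> x /= /not_implyP[Bx]; apply: contra_notP => /eqP x0.
  by rewrite fineK// bridge_mass_fin_num.
Qed.

End posterior.

(** * The Bayes formula along the natural filtration *)

Section density_measure.
Context {d : measure_display} {T : measurableType d} {R : realType}.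
Variables (m : {measure set T -> \bar R}) (f : T -> \bar R).
Hypotheses (f0 : forall x, (0 <= f x)%E) (mf : measurable_fun setT f).

(** As for [image_measure], the proofs are arguments of the measure. *)
Definition density_measure & (forall x, (0 <= f x)%E) & measurable_fun setT f :=
  fun A : set T => (\int[m]_(x in A) f x)%E.

Let density0 : density_measure f0 mf set0 = 0%E.
Proof. exact: integral_set0. Qed.

Let density_ge0 A : (0 <= density_measure f0 mf A)%E.
Proof. by apply: integral_ge0 => x _. Qed.

Let density_sigma_additive : semi_sigma_additive (density_measure f0 mf).
Proof.
move=> A mA tA mUA; rewrite /density_measure ge0_integral_bigcup//=; last first.
  exact: measurable_funTS.
apply: is_cvg_ereal_nneg_natsum_cond => n _ _.
by apply: integral_ge0 => x _.
Qed.

HB.instance Definition _ := isMeasure.Build _ _ _ (density_measure f0 mf)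
  density0 density_ge0 density_sigma_additive.

End density_measure.

Lemma ge0_integral_mrestr {d : measure_display} {T : measurableType d}
    {R : realType} (m : {finite_measure set T -> \bar R}) (D E : set T)
    (mE : measurable E) (f : T -> \bar R) :
  measurable D -> measurable_fun setT f -> (forall x, (0 <= f x)%E) ->
  (\int[mrestr m mE]_(x in D) f x = \int[m]_(x in D `&` E) f x)%E.
Proof.
move=> mD mf f0.
rewrite [LHS](ge0_integral_density (mu := m) (h := \1_E))//; last first.
  by move=> A mA; rewrite integral_indic// setIC.
rewrite [LHS]integral_mkcond [RHS]integral_mkcond.
apply: eq_integral => x _; rewrite !patchE in_setI indicE.
by case: (x \in D); case: (x \in E); rewrite /= ?mule1 ?mule0.
Qed.

Section bayes.
Context {d : measure_display} {Omega : measurableType d} {R : realType}.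
Variables (P : probability Omega R) (W : R -> Omega -> R).
Hypothesis W_bm : is_brownian_motion P W.
Variable tau : {RV P >-> R}.
Hypothesis tau_indep : independent_of_process P tau W.
Local Notation beta := (information_process W tau).
Local Notation law := (default_law tau).
Local Notation mu := (@lebesgue_measure R).

Lemma measurable_alive (t : R) : measurable [set w | t < tau w].
Proof.
rewrite (_ : [set w | _] = tau @^-1` `]t, +oo[).
  by rewrite -[X in measurable X]setTI; exact: measurable_funPT.
by apply/seteqP; split => w /=; rewrite in_itv/= andbT.
Qed.

Let mI s I : 0 < s -> process_sigma (bridge W s) `]0, s[ I -> measurable I.
Proof. by move=> s0 sI; apply: (path_generators_sub W_bm); exact: bridge_sigma_path sI. Qed.

(** [past_default_indep] and [default_information_law] combined. The maximum with
    [s] confines the event to [s < tau], where the density lives. *)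
Let P_mass (s u : R) (I : set Omega) (B : set R) : 0 < s ->
  process_sigma (bridge W s) `]0, s[ I -> measurable B ->
  P (I `&` [set w | Num.max u s < tau w /\ B (beta s w)]) =
  (P I * \int[mu]_(x in B) (fine (bridge_mass tau s u x))%:E)%E.
Proof.
move=> s0 sI mB.
have setE : [set w | Num.max u s < tau w /\ B (beta s w)] =
    [set w | `]Num.max u s, +oo[%classic (tau w) /\ B (beta s w)].
  by apply/seteqP; split => w /=; rewrite in_itv/= andbT.
rewrite setE (past_default_indep W_bm tau_indep s0 sI)//; congr (_ * _)%E.
rewrite (default_information_law W_bm tau_indep s0)//; last first.
  by move=> r /=; rewrite !in_itv/= !andbT gt_max => /andP[].
rewrite (integral_fine_bridge_mass tau u s0 mB).
apply: eq_integral => x _.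
exact: bridge_mass_max.
Qed.

(** On [s < tau], [beta s] has a density. This excludes the value [0], at which
    the posterior law is not controlled. *)
Lemma information_neq0 (s : R) : 0 < s ->
  {ae P, forall w, s < tau w -> beta s w != 0}.
Proof.
move=> s0.
have sT : process_sigma (bridge W s) `]0, s[ setT.
  exact: (@measurableT _ (g_sigma_algebraType _)).
have := P_mass s s0 sT (measurable_set1 0).
rewrite setTI maxxx integral_set1 mule0 => P0.
exists [set w | s < tau w /\ [set 0] (beta s w)]; split => //.
- apply: measurableI; first exact: measurable_alive.
  rewrite -[X in measurable X]setTI.
  exact: (measurable_information_process W_bm tau (ltW s0)).
- by move=> w /= /not_implyP[sw /negP]; rewrite negbK => /eqP.
Qed.

Lemma measurable_posterior_tail_information (s u : R) : 0 < s ->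
  measurable_fun setT (fun w => (posterior_tail tau s u (beta s w))%:E).
Proof.
move=> s0; apply/measurable_EFinP.
apply: (measurableT_comp (measurable_posterior_tail tau u s0)).
exact: (measurable_information_process W_bm tau (ltW s0)).
Qed.

(** Under [P] restricted to [I] and [s < tau], [beta s] has the density
    [P I * bridge_mass s s], and multiplying it by [posterior_tail s u] leaves
    [P I * bridge_mass s u]. *)
Let bayes_rect (s u : R) (I : set Omega) (B : set R) : 0 < s ->
  process_sigma (bridge W s) `]0, s[ I -> measurable B ->
  (\int[P]_(w in I `&` beta s @^-1` B `&` [set w | (s < tau w)%R])
     (posterior_tail tau s u (beta s w))%:E)%E =
  P (I `&` beta s @^-1` B `&` [set w | Num.max u s < tau w]).
Proof.
move=> s0 sI mB.
have mIE : measurable (I `&` [set w | s < tau w]).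
  by apply: measurableI; [exact: mI sI|exact: measurable_alive].
have mb : measurable_fun setT (beta s : Omega -> measurableTypeR R).
  exact: (measurable_information_process W_bm tau (ltW s0)).
pose nu := image_measure (mrestr P mIE) mb.
pose p := fine (P I).
have p0 : 0 <= p by rewrite fine_ge0.
have pE : P I = p%:E by rewrite fineK// fin_num_measure//; exact: mI sI.
pose h x := p * fine (bridge_mass tau s s x).
have mfine v : measurable_fun setT (fun x => fine (bridge_mass tau s v x)).
  apply: (measurableT_comp (f := @fine R)); first exact: fine_measurable.
  exact: measurable_bridge_mass.
have mpf v : measurable_fun setT (fun x => p * fine (bridge_mass tau s v x)).
  by apply: measurable_funM => //; exact: mfine.
have fine0 v x : 0 <= fine (bridge_mass tau s v x).
  by rewrite fine_ge0// bridge_mass_ge0.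
have nuE A : measurable A -> nu A = (\int[mu]_(x in A) (h x)%:E)%E.
  move=> mA; transitivity (P (I `&` [set w | Num.max s s < tau w /\ A (beta s w)])).
    rewrite maxxx; congr (P _); apply/seteqP.
    by split => w /= [? [? ?]].
  rewrite P_mass// pE -ge0_integralZl_EFin//.
  - by move=> x _; rewrite lee_fin fine0.
  - by apply/measurable_EFinP; exact: measurable_funTS (mfine s).
have mpost : measurable_fun setT
    (fun x : measurableTypeR R => (posterior_tail tau s u x)%:E).
  by apply/measurable_EFinP; exact: measurable_posterior_tail.
transitivity (\int[nu]_(x in B) (posterior_tail tau s u x)%:E)%E.
  rewrite ge0_integral_pushforward//; last 2 first.
  - exact: measurable_funTS.
  - by move=> x _; rewrite lee_fin posterior_tail_ge0.
  rewrite ge0_integral_mrestr//.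
  - by congr (integral _ _ _); apply/seteqP; split => w /=; tauto.
  - by rewrite -[X in measurable X]setTI; exact: (mb _ B mB).
  - exact: measurable_posterior_tail_information.
  - by move=> w; rewrite lee_fin posterior_tail_ge0.
rewrite (ge0_integral_density (mu := mu) (h := h))//; last 3 first.
- exact: mpf.
- by move=> x; rewrite mulr_ge0.
- by move=> x; rewrite lee_fin posterior_tail_ge0.
transitivity (P (I `&` [set w | Num.max u s < tau w /\ B (beta s w)])); last first.
  by congr (P _); apply/seteqP; split => w /=; tauto.
rewrite P_mass// pE -ge0_integralZl_EFin//; last 2 first.
- by move=> x _; rewrite lee_fin fine0.
- by apply/measurable_EFinP; exact: measurable_funTS (mfine u).
apply: ge0_ae_eq_integral => //.
- apply/measurable_EFinP; apply: measurable_funTS; apply: measurable_funM.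
    exact: measurable_posterior_tail.
  exact: mpf.
- by apply/measurable_EFinP; apply: measurable_funTS; exact: mpf.
- by move=> x _; rewrite mule_ge0// lee_fin ?posterior_tail_ge0// mulr_ge0.
- by move=> x _; rewrite lee_fin mulr_ge0.
exists [set 0]; split => //; first exact: lebesgue_measure_set1.
move=> x /= /not_implyP[Bx]; apply: contra_notP => /eqP x0.
rewrite -!EFinM; congr EFin; rewrite /posterior_tail /h mulrCA.
congr *%R; have := bridge_mass_le tau u x s0; have := bridge_mass_ge0 tau s u x.
rewrite -(fineK (bridge_mass_fin_num tau u s0 x0)).
rewrite -(fineK (bridge_mass_fin_num tau s s0 x0)) !lee_fin => h1 h2 /=.
have [e|n0] := eqVneq (fine (bridge_mass tau s s x)) 0; last by rewrite divfK.
by rewrite e mulr0; apply/esym/eqP; rewrite eq_le h1 -e h2.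
Qed.

(** The decomposition on which everything rests: the bridge of length [s] does not
    involve [tau]. *)
Lemma information_bridge (s u : R) (w : Omega) : 0 < s -> 0 <= u -> u <= s ->
  s < tau w -> beta u w = bridge W s u w + u / s * beta s w.
Proof.
move=> s0 u0 us sw; rewrite /information_process !max_l ?(ltW sw)//; last first.
  exact: le_trans (ltW sw).
rewrite /bridge; field.
by rewrite !gt_eqF// (lt_trans s0).
Qed.

Let past_rects (s : R) : set (set Omega) :=
  [set I `&` beta s @^-1` B | I in process_sigma (bridge W s) `]0, s[
                            & B in measurable].

(** On [s < tau], by [information_bridge], an event of the natural filtration at
    time [s] depends only on [beta s] and on the bridge of length [s]. *)
Let natural_trace (s : R) (A : set Omega) : 0 < s ->
  natural_filtration beta s A ->
  exists2 A', <<s past_rects s >> A' &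
    A `&` [set w | s < tau w] = A' `&` [set w | s < tau w].
Proof.
move=> s0; pose OG := g_sigma_algebraType (past_rects s).
have sT : process_sigma (bridge W s) `]0, s[ setT.
  exact: (@measurableT _ (g_sigma_algebraType _)).
have mbeta : measurable_fun (setT : set OG) (beta s).
  move=> _ B mB; rewrite setTI; apply: sub_sigma_algebra.
  by exists setT => //; exists B => //; rewrite setTI.
have mbr u : 0 <= u -> u <= s -> measurable_fun (setT : set OG) (bridge W s u).
  rewrite le_eqVlt => /predU1P[<- _|u0].
    rewrite (_ : bridge _ _ _ = cst 0); first exact: measurable_cst.
    by apply/funext => w; rewrite /bridge mul0r mul0r (bm_start W_bm) subrr.
  rewrite le_eqVlt => /predU1P[->|us].
    rewrite (_ : bridge _ _ _ = cst 0); first exact: measurable_cst.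
    by apply/funext => w; rewrite /bridge divff ?gt_eqF// mul1r subrr.
  move=> _ B mB; rewrite setTI; apply: sub_sigma_algebra.
  exists (bridge W s u @^-1` B); last by exists setT => //; rewrite preimage_setT setIT.
  apply: sub_sigma_algebra; exists u; first by rewrite /= in_itv/= u0.
  by exists B => //; rewrite setTI.
apply: (smallest_sub (X := [set A | exists2 A', <<s past_rects s >> A' &
    A `&` [set w | s < tau w] = A' `&` [set w | s < tau w]])); first split.
- by exists set0 => //; exact: (@measurable0 _ OG).
- move=> B [B' GB' BB']; exists (~` B'); first exact: (@measurableC _ OG).
  have BBw w : s < tau w -> B w <-> B' w.
    move=> sw; have BB := BB'.
    split => h.
      by have : (B `&` [set w | s < tau w]) w by []; rewrite BB => -[].
    by have : (B' `&` [set w | s < tau w]) w by []; rewrite -BB => -[].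
  by apply/seteqP; split => w /= [Bw sw]; have := BBw w sw; tauto.
- move=> F GF.
  have GF' n : {A' | <<s past_rects s >> A' /\
      F n `&` [set w | s < tau w] = A' `&` [set w | s < tau w]}.
    by apply: cid; have [A' GA' FA'] := GF n; exists A'.
  exists (\bigcup_n sval (GF' n)).
    by apply: (@bigcupT_measurable _ OG) => n; exact: (svalP (GF' n)).1.
  rewrite !setI_bigcupl; apply: eq_bigcupr => n _; exact: (svalP (GF' n)).2.
- move=> A0 [u]; rewrite /= in_itv/= => /andP[u0 us] [B mB <-].
  exists ((fun w => bridge W s u w + u / s * beta s w) @^-1` B).
    have : measurable_fun (setT : set OG)
        (fun w => bridge W s u w + u / s * beta s w).
      by apply: measurable_funD; [exact: mbr|exact: measurable_funM].
    by move=> /(_ measurableT B mB); rewrite setTI.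
  apply/seteqP; split => w /=.
    by move=> [[_ +] sw]; rewrite (information_bridge s0 u0 us sw).
  by move=> [+ sw]; rewrite -(information_bridge s0 u0 us sw).
Qed.

(** [natural_trace] replaces [A] by an event generated by the pi-system of the
    rectangles of [bayes_rect]. *)
Lemma bayes_natural (s u : R) (A : set Omega) : 0 < s ->
  natural_filtration beta s A ->
  (\int[P]_(w in A `&` [set w | (s < tau w)%R])
     (posterior_tail tau s u (beta s w))%:E)%E =
  P (A `&` [set w | Num.max u s < tau w]).
Proof.
move=> s0 /(natural_trace s0)[A' GA' AA'].
have AA'u : A `&` [set w | Num.max u s < tau w] =
    A' `&` [set w | Num.max u s < tau w].
  have -> : [set w | Num.max u s < tau w] =
      [set w | s < tau w] `&` [set w | u < tau w].
    apply/seteqP; split => w /=; rewrite gt_max; first by case/andP.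
    by case=> -> ->.
  by rewrite !setIA AA'.
rewrite AA' AA'u.
have post0 w : (0 <= (posterior_tail tau s u (beta s w))%:E)%E.
  by rewrite lee_fin posterior_tail_ge0.
have mpost := measurable_posterior_tail_information u s0.
have mE := measurable_alive s.
have mEu := measurable_alive (Num.max u s).
pose m1 := density_measure (mrestr P mE) post0 mpost.
have m1E A0 : measurable A0 -> m1 A0 = (\int[P]_(w in A0 `&` [set w | (s < tau w)%R])
     (posterior_tail tau s u (beta s w))%:E)%E.
  by move=> mA0; rewrite /m1 /density_measure ge0_integral_mrestr.
have Gm : past_rects s `<=` measurable.
  move=> _ [I sI [B mB <-]]; apply: measurableI; first exact: mI sI.
  rewrite -[X in measurable X]setTI.
  exact: (measurable_information_process W_bm tau (ltW s0)).
have sT : process_sigma (bridge W s) `]0, s[ setT.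
  exact: (@measurableT _ (g_sigma_algebraType _)).
have GT : past_rects s setT.
  by exists setT => //; exists setT => //; rewrite preimage_setT setIT.
have m12 A0 : past_rects s A0 -> m1 A0 = mrestr P mEu A0.
  by move=> GA0; rewrite m1E; [case: GA0 => I sI [B mB <-]; exact: bayes_rect
    |exact: Gm].
rewrite -m1E; last first.
  by apply: (smallest_sub (@sigma_algebra_measurable _ Omega) Gm).
apply: (g_sigma_algebra_measure_unique _ Gm (fun=> setT) (fun=> GT) _
  m1 (mrestr P mEu)) => //.
- by rewrite bigcup_const.
- move=> _ _ [I sI [B mB <-]] [I' sI' [B' mB' <-]].
  exists (I `&` I').
    exact: (@measurableI _ (g_sigma_algebraType _)).
  by exists (B `&` B'); [exact: measurableI|rewrite preimage_setI setIACA].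
- move=> _; apply: (@le_lt_trans _ _ (mrestr P mEu setT)).
    by rewrite -(m12 _ GT).
  by rewrite ltey_eq fin_num_measure.
Qed.

End bayes.

(** * Right limits of the Bayes formula *)

Section density_limit.
Context {R : realType}.
Variables (t x : R) (s_ x_ : R^nat).
Hypotheses (t0 : 0 < t) (ts : forall n, t <= s_ n).
Hypotheses (s_t : s_ n @[n --> \oo] --> t) (x_x : x_ n @[n --> \oo] --> x).

Lemma bridge_density_cvg (r : R) :
  bridge_density (s_ n) r (x_ n) @[n --> \oo] --> bridge_density t r x.
Proof.
have [rt|tr] := leP r t.
  rewrite bridge_density0//.
  rewrite (_ : (fun n => _) = cst 0); first exact: cvg_cst.
  by apply/funext => n; rewrite bridge_density0// (le_trans rt).
have r0 : 0 < r by exact: lt_trans tr.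
have a0 : 0 < t * (r - t) / r by rewrite divr_gt0// mulr_gt0// subr_gt0.
rewrite {2}/bridge_density t0 tr/=.
have h : \forall n \near \oo, s_ n < r by exact: (cvgr_lt t).
apply: cvg_trans.
  apply: near_eq_cvg; near=> n.
  have -> : bridge_density (s_ n) r (x_ n) =
      gauss_density (s_ n * (r - s_ n) / r) (x_ n) 0.
    by rewrite /bridge_density (lt_le_trans t0 (ts n)) (near h n).
  reflexivity.
have a_ : s_ n * (r - s_ n) / r @[n --> \oo] --> t * (r - t) / r.
  apply: cvgM; last exact: cvg_cst.
  by apply: cvgM => //; apply: cvgB => //; exact: cvg_cst.
rewrite /gauss_density; apply: cvgM.
  apply: cvgV.
    by rewrite gt_eqF// sqrtr_gt0 mulr_gt0// mulr_gt0// pi_gt0.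
  apply: (@continuous_cvg _ _ _ _ _ _ (@Num.sqrt R)); first exact: sqrt_continuous.
  by apply: cvgM => //; exact: cvg_cst.
apply: (@continuous_cvg _ _ _ _ _ _ (@expR R)); first exact: continuous_expR.
apply: cvgM.
  apply: cvgN; rewrite !subr0; under eq_fun do rewrite subr0.
  apply: (@continuous_cvg _ _ _ _ _ _ (fun y : R => y ^+ 2)) => //.
  exact: exprn_continuous.
apply: cvgV; first by rewrite gt_eqF// mulr_gt0.
by apply: cvgM => //; exact: cvg_cst.
Unshelve. all: by end_near. Qed.

Context {d : measure_display} {Omega : measurableType d}.
Variables (P : probability Omega R) (tau : {RV P >-> R}).
Local Notation law := (default_law tau).
Local Notation TR := (measurableTypeR R).

(** Dominated convergence with the bound of [bridge_density_le], since
    [1 / `|x_ n|] eventually stays below [1 / `|x| + 1]. *)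
Lemma bridge_mass_cvg (u : R) : x != 0 ->
  fine (bridge_mass tau (s_ n) u (x_ n)) @[n --> \oo] -->
  fine (bridge_mass tau t u x).
Proof.
move=> x0; have s0 n : 0 < s_ n by exact: lt_le_trans (ts n).
pose M := `|x|^-1 + 1.
have xV : `|x_ n|^-1 @[n --> \oo] --> `|x|^-1.
  by apply: cvgV; [rewrite normr_eq0|exact: cvg_norm].
have [N _ NM] : \forall n \near \oo, (x_ n != 0) /\ `|x_ n|^-1 <= M.
  near=> n; split.
    rewrite -normr_gt0; near: n.
    apply: (cvgr_gt `|x|); [exact: cvg_norm|by rewrite normr_gt0].
  near: n; apply: (cvgr_le `|x|^-1) => //.
  by rewrite /M ltrDl.
rewrite -(cvg_shiftn N); apply: fine_cvg; rewrite /=.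
rewrite fineK ?bridge_mass_fin_num//.
have mbd s y : 0 < s ->
    measurable_fun setT (fun r : TR => (bridge_density s r y)%:E).
  move=> s0'; apply/measurable_EFinP.
  exact: (measurable_fun_pair1 y (measurable_bridge_density s0')).
have intM : law.-integrable `]u, +oo[ (cst M%:E).
  by apply: finite_measure_integrable_cst; exact: measurable_itv.
have [] := @dominated_convergence _ _ _ law `]u, +oo[%classic (measurable_itv _)
  (fun n r => (bridge_density (s_ (n + N)%N) r (x_ (n + N)%N))%:E)
  (fun r => (bridge_density t r x)%:E) (cst M%:E) _ _ _ intM _ => //.
- by move=> n; apply: measurable_funTS; exact: mbd.
- by apply: measurable_funTS; exact: mbd.
- apply: aeW => r _; apply: cvg_EFin; first exact: nearW.
  have := @bridge_density_cvg r; rewrite -(cvg_shiftn N); exact.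
- apply: aeW => r n _.
  rewrite gee0_abs ?lee_fin ?bridge_density_ge0//.
  have [xn0 xnM] := NM (n + N)%N (leq_addl _ _).
  exact: le_trans (bridge_density_le _ _ xn0) xnM.
Unshelve. all: by end_near. Qed.

End density_limit.

Section right_limit.
Context {d : measure_display} {Omega : measurableType d} {R : realType}.
Variables (P : probability Omega R) (W : R -> Omega -> R).
Hypothesis W_bm : is_brownian_motion P W.
Variable tau : {RV P >-> R}.
Hypothesis tau_indep : independent_of_process P tau W.
Local Notation beta := (information_process W tau).
Local Notation law := (default_law tau).
Local Notation TR := (measurableTypeR R).

Lemma information_cvg (t : R) (s_ : R^nat) (w : Omega) : 0 < t -> t < tau w ->
  (forall n, t <= s_ n) -> s_ n @[n --> \oo] --> t ->
  beta (s_ n) w @[n --> \oo] --> beta t w.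
Proof.
move=> t0 tw ts s_t.
have h : \forall n \near \oo, s_ n < tau w by exact: (cvgr_lt t).
rewrite [X in _ --> X]/information_process max_l ?(ltW tw)//.
apply: cvg_trans.
  apply: near_eq_cvg; near=> n.
  have -> : beta (s_ n) w = W (s_ n) w - s_ n / tau w * W (tau w) w.
    by rewrite /information_process max_l// ltW// (near h n).
  reflexivity.
apply: cvgB.
  apply: (path_cvg W_bm) => //; last exact: ltW.
  by move=> n; rewrite (le_trans (ltW t0)).
apply: cvgM; last exact: cvg_cst.
by apply: cvgM => //; exact: cvg_cst.
Unshelve. all: by end_near. Qed.

(** The density is positive at every [r > t], and [tau] charges [ ]t, +oo[ ]. *)
Lemma bridge_mass_neq0 (t x : R) : 0 < t -> x != 0 ->
  P [set w | t < tau w] != 0%E -> fine (bridge_mass tau t t x) != 0.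
Proof.
move=> t0 x0; apply: contra_neq => m0.
have {}m0 : bridge_mass tau t t x = 0%E.
  by rewrite -(fineK (bridge_mass_fin_num tau t t0 x0)) m0.
have mtail : measurable (`]t, +oo[%classic : set TR) by exact: measurable_itv.
have mbd : measurable_fun `]t, +oo[ (fun r : TR => (bridge_density t r x)%:E).
  apply: measurable_funTS; apply/measurable_EFinP.
  exact: (measurable_fun_pair1 x (measurable_bridge_density t0)).
have /(ae_eq_integral_abs law mtail mbd) : (\int[law]_(r in `]t, +oo[)
    `|(bridge_density t r x)%:E| = 0)%E.
  rewrite -[RHS]m0; apply: eq_integral => r _.
  by rewrite gee0_abs// lee_fin bridge_density_ge0.
move=> [N [mN N0 tN]].
have : (law `]t, +oo[%classic <= law N)%E.
  apply: le_measure; rewrite ?inE// => r /= tr; apply: tN => /= /(_ tr).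
  move: tr; rewrite in_itv/= andbT => tr.
  rewrite /bridge_density t0 tr/= => -[] /eqP.
  rewrite mulf_eq0 (gt_eqF (expR_gt0 _)) orbF invr_eq0 sqrtr_eq0 leNgt.
  have r0 : 0 < r by exact: lt_trans tr.
  have a0 : 0 < t * (r - t) / r by rewrite divr_gt0// mulr_gt0// subr_gt0.
  by rewrite mulr_gt0// mulr_gt0// pi_gt0.
rewrite N0 measure_le0 => /eqP; apply: etrans.
congr (P _); apply/seteqP; split => w /=; by rewrite in_itv/= andbT.
Qed.

Lemma posterior_tail_cvg (t u : R) (s_ : R^nat) (w : Omega) : 0 < t ->
  t < tau w -> beta t w != 0 -> P [set w | t < tau w] != 0%E ->
  (forall n, t <= s_ n) -> s_ n @[n --> \oo] --> t ->
  posterior_tail tau (s_ n) u (beta (s_ n) w) @[n --> \oo] -->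
  posterior_tail tau t u (beta t w).
Proof.
move=> t0 tw b0 Pt ts s_t; have bb := information_cvg t0 tw ts s_t.
apply: cvgM.
  exact: (bridge_mass_cvg t0 ts s_t bb).
apply: cvgV; first exact: bridge_mass_neq0.
rewrite (_ : (fun n => _) =
    (fun n => fine (bridge_mass tau (s_ n) t (beta (s_ n) w)))).
  exact: (bridge_mass_cvg t0 ts s_t bb).
apply/funext => n; congr fine.
by rewrite -[LHS]bridge_mass_max -[RHS]bridge_mass_max maxxx max_r.
Qed.

(** [bayes_natural] at the times [t + 1 / n.+1], followed by dominated convergence
    on the left, where the posterior tail is at most [1], and continuity of [P]
    along increasing events on the right. *)
Lemma bayes_right (t u : R) (A : set Omega) : 0 < t ->
  (forall s, t < s -> natural_filtration beta s A) ->
  (\int[P]_(w in A `&` [set w | (t < tau w)%R])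
     (posterior_tail tau t u (beta t w))%:E)%E =
  P (A `&` [set w | Num.max u t < tau w]).
Proof.
move=> t0 At.
have mA : measurable A.
  have := At (t + 1); rewrite ltrDl => /(_ ltr01); apply: process_sigma_sub.
  move=> s; rewrite /= in_itv/= => /andP[s0 _].
  exact: (measurable_information_process W_bm tau s0).
have mE := measurable_alive tau.
(* Without mass beyond [t] the normalization degenerates, but all terms vanish. *)
have [Pt|Pt] := eqVneq (P [set w | t < tau w]) 0%E.
  have null B : measurable B -> B `<=` [set w | t < tau w] -> P B = 0%E.
    by move=> mB Bt; apply/eqP; rewrite -measure_le0 -Pt le_measure ?inE//; exact: mE.
  have mAE v : measurable (A `&` [set w | v < tau w]).
    by apply: measurableI => //; exact: mE.
  have PAE : P (A `&` [set w | t < tau w]) = 0%E by apply: null => // w [].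
  have PAEu : P (A `&` [set w | Num.max u t < tau w]) = 0%E.
    by apply: null => // w /= [_]; rewrite gt_max => /andP[].
  rewrite PAEu null_set_integral//; apply: measurable_funTS.
  exact: (measurable_posterior_tail_information W_bm tau u t0).
pose s_ n : R := t + n.+1%:R^-1.
have ts n : t < s_ n by rewrite ltrDl invr_gt0.
have s0 n : 0 < s_ n by exact: lt_trans (ts n).
have s_t : s_ n @[n --> \oo] --> t.
  rewrite -[X in _ --> X]addr0; apply: cvgD; first exact: cvg_cst.
  exact: cvg_harmonic.
pose f_ n w := (\1_[set w | s_ n < tau w] w * posterior_tail tau (s_ n) u (beta (s_ n) w))%:E.
pose f w := (\1_[set w | t < tau w] w * posterior_tail tau t u (beta t w))%:E.
have mf s : 0 < s -> measurable_fun setT (fun w =>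
    (\1_[set w | s < tau w] w * posterior_tail tau s u (beta s w))%:E).
  move=> s0'; apply/measurable_EFinP; apply: measurable_funM.
    by apply: measurable_indic; exact: mE.
  by apply/measurable_EFinP;
    exact: (measurable_posterior_tail_information W_bm tau u s0').
have intE s : (\int[P]_(w in A `&` [set w | (s < tau w)%R])
     (posterior_tail tau s u (beta s w))%:E = \int[P]_(w in A)
    (\1_[set w | s < tau w] w * posterior_tail tau s u (beta s w))%:E)%E.
  rewrite [LHS]integral_mkcond [RHS]integral_mkcond; apply: eq_integral => w _.
  rewrite !patchE in_setI indicE.
  by case: (w \in A); case: (w \in _); rewrite /= ?mul1r ?mul0r.
have mf_ n : measurable_fun A (f_ n) by apply: measurable_funTS; exact: mf.
have mft : measurable_fun A f by apply: measurable_funTS; exact: mf.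
have ae1 : {ae P, forall w, A w -> f_ ^~ w @ \oo --> f w}.
  apply: filterS (information_neq0 W_bm tau_indep t0) => w bw _.
  have [tw|wt] := ltP t (tau w); last first.
    rewrite (_ : f_ ^~ w = cst (f w)); first exact: cvg_cst.
    have out v : t <= v -> (w \in [set w | v < tau w]) = false.
      move=> tv; apply/negbTE; rewrite notin_setE/=.
      by move=> /(le_lt_trans (le_trans wt tv)); rewrite ltxx.
    by apply/funext => n; rewrite /f_ /f !indicE !out ?mul0r// ltW.
  apply: cvg_EFin; first exact: nearW.
  have -> : \1_[set w0 | t < tau w0] w = 1 :> R by rewrite indicE mem_set.
  rewrite mul1r.
  have h : \forall n \near \oo, s_ n < tau w by exact: (cvgr_lt t).
  have := @posterior_tail_cvg t u s_ w t0 tw (bw tw) Pt (fun n => ltW (ts n)) s_t.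
  apply: cvg_trans; apply: near_eq_cvg; near=> n.
  have sw : s_ n < tau w by exact: (near h n).
  have one : \1_[set w0 | s_ n < tau w0] w = 1 :> R by rewrite indicE mem_set.
  by rewrite /f_ /= one mul1r.
have ae2 : {ae P, forall w n, A w -> (`|f_ n w| <= cst 1%:E w)%E}.
  apply: aeW => w n _; rewrite gee0_abs.
    rewrite lee_fin; apply: mulr_ile1 => //; first exact: posterior_tail_ge0.
    exact: posterior_tail_le1.
  by rewrite lee_fin mulr_ge0// posterior_tail_ge0.
have [_ _] := dominated_convergence mA mf_ mft ae1
  (finite_measure_integrable_cst P 1 mA) ae2.
have bayes_n n : (\int[P]_(w in A) f_ n w = P (A `&` [set w | (Num.max u (s_ n) < tau w)%R]))%E.
  by rewrite /f_ -intE; apply: (bayes_natural W_bm tau_indep) => //; exact: At.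
rewrite (_ : [sequence _]_n = (fun n => P (A `&` [set w | Num.max u (s_ n) < tau w]))); last first.
  by apply/funext => n; exact: bayes_n.
rewrite -intE => cv1.
apply: (cvg_unique _ cv1) => //.
have -> : A `&` [set w | Num.max u t < tau w] =
    \bigcup_n (A `&` [set w | Num.max u (s_ n) < tau w]).
  rewrite -setI_bigcupr; congr (_ `&` _); apply/seteqP; split => w /=.
    rewrite gt_max => /andP[uw tw].
    have [n _ /(_ n (leqnn n)) sw] : \forall n \near \oo, s_ n < tau w by exact: (cvgr_lt t).
    by exists n => //=; rewrite gt_max uw.
  move=> [n _ /=]; rewrite !gt_max => /andP[-> /(lt_trans (ts n))//].
apply: nondecreasing_cvg_mu.
- by move=> n; apply: measurableI => //; exact: mE.
- by apply: bigcupT_measurable => n; apply: measurableI => //; exact: mE.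
- move=> m n mn; apply/subsetPset => w /= [Aw]; rewrite !gt_max => /andP[uw sw].
  split => //; rewrite uw/=; apply: le_lt_trans sw.
  by rewrite lerD2l lef_pV2 ?posrE// ler_nat.
Unshelve. all: by end_near. Qed.

End right_limit.

(** * The right-continuous completed filtration *)

Section completion.
Context {d : measure_display} {Omega : measurableType d} {R : realType}.
Variable P : probability Omega R.

Lemma ae_eq_set_integral (A B : set Omega) (f : Omega -> \bar R) :
  measurable A -> measurable B -> measurable_fun setT f ->
  (forall w, 0 <= f w)%E -> {ae P, forall w, A w <-> B w} ->
  (\int[P]_(w in A) f w = \int[P]_(w in B) f w)%E.
Proof.
move=> mA mB mf f0 AB; rewrite integral_mkcond [RHS]integral_mkcond.
apply: ge0_ae_eq_integral => //.
- by apply/(measurable_restrictT _ mA); exact: measurable_funTS.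
- by apply/(measurable_restrictT _ mB); exact: measurable_funTS.
- by move=> w _; rewrite patchE; case: ifP.
- by move=> w _; rewrite patchE; case: ifP.
- apply: filterS AB => w AB _; rewrite !patchE.
  suff -> : (w \in A) = (w \in B) by [].
  by apply/idP/idP; rewrite !inE => /AB.
Qed.

Lemma ae_eq_set_probability (A B : set Omega) :
  measurable A -> measurable B -> {ae P, forall w, A w <-> B w} -> P A = P B.
Proof.
move=> mA mB AB.
have := @ae_eq_set_integral A B (cst 1%E) mA mB (measurable_cst _) (fun=> lee01) AB.
by rewrite !integral_cst// !mul1e.
Qed.

(** The sets that agree almost everywhere with one of [C] form a sigma-algebra. *)
Lemma completion_approx (C : set (set Omega)) (A : set Omega) :
  sigma_algebra setT C -> <<s C `|` P.-negligible >> A ->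
  exists2 B, C B & {ae P, forall w, A w <-> B w}.
Proof.
move=> sC; have [C0 CC CU] := sC.
apply: (smallest_sub (X := [set A | exists2 B, C B & {ae P, forall w, A w <-> B w}])).
  split.
  - by exists set0 => //; exact: aeW.
  - move=> A0 [B CB AB]; exists (setT `\` B); first exact: CC.
    by apply: filterS AB => w /=; tauto.
  - move=> F CF.
    have F' n : {B | C B /\ {ae P, forall w, F n w <-> B w}}.
      by apply: cid; have [B CB FB] := CF n; exists B.
    exists (\bigcup_n sval (F' n)); first by apply: CU => n; exact: (svalP (F' n)).1.
    have : {ae P, forall w n, F n w <-> sval (F' n) w}.
      by apply: ae_foralln => n; exact: (svalP (F' n)).2.
    apply: filterS => w FF; split => -[n _ Fw]; exists n => //; exact/FF.
move=> A0 [CA|NA]; first by exists A0 => //; exact: aeW.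
exists set0 => //; apply: negligibleS NA => w /=.
by apply: contra_notP => nA; split.
Qed.

End completion.

Section filtration.
Context {d : measure_display} {Omega : measurableType d} {R : realType}.
Variable P : probability Omega R.
Hypothesis P_complete : measure_is_complete P.
Variable W : R -> Omega -> R.
Hypothesis W_bm : is_brownian_motion P W.
Variable tau : {RV P >-> R}.
Hypothesis tau_gt0 : forall w, 0 < tau w.
Hypothesis tau_indep : independent_of_process P tau W.
Local Notation beta := (information_process W tau).

(** The generators in the definition of [right_completed_filtration], named so
    that results on [<<s G >>] apply to it by conversion. *)
Definition filtration_generators (t : R) : set (set Omega) :=
  (\bigcap_(u in `]t, +oo[) natural_filtration beta u) `|` P.-negligible.

Let C t := \bigcap_(u in `]t, +oo[) natural_filtration beta u.

Let C_sigma t : sigma_algebra setT (C t).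
Proof. by apply: sigma_algebra_bigcap => u _; exact: smallest_sigma_algebra. Qed.

Lemma natural_filtration_sub u : natural_filtration beta u `<=` measurable.
Proof.
apply: process_sigma_sub => s; rewrite /= in_itv/= => /andP[s0 _].
exact: (measurable_information_process W_bm tau s0).
Qed.

Lemma filtration_sub t : <<s filtration_generators t >> `<=` measurable.
Proof.
apply: smallest_sub; first exact: sigma_algebra_measurable.
move=> A [CA|]; last exact: P_complete.
apply: (@natural_filtration_sub (t + 1)); apply: CA.
by rewrite /= in_itv/= andbT ltrDl.
Qed.

Lemma filtration_null t : P.-negligible `<=` <<s filtration_generators t >>.
Proof. by move=> A NA; apply: sub_sigma_algebra; right. Qed.

Lemma information_adapted t : 0 <= t ->
  measurable_fun (setT : set (g_sigma_algebraType (filtration_generators t)))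
    (beta t).
Proof.
move=> t0 _ B mB; apply: sub_sigma_algebra; left => u.
rewrite /= in_itv/= andbT => tu; apply: sub_sigma_algebra.
by exists t; [rewrite /= in_itv/= t0 ltW|exists B].
Qed.

(** [beta t] vanishes on [tau <= t], and only on a null part of [t < tau]. *)
Lemma alive_adapted t : 0 <= t ->
  <<s filtration_generators t >> [set w | t < tau w].
Proof.
pose OG := g_sigma_algebraType (filtration_generators t).
rewrite le_eqVlt => /predU1P[t0|t0].
  rewrite (_ : [set w | _] = setT); first exact: (@measurableT _ OG).
  by apply/seteqP; split => w //= _; rewrite -t0.
rewrite (_ : [set w | _] = (beta t @^-1` [set~ 0]) `|`
    [set w | t < tau w /\ beta t w = 0]); last first.
  apply/seteqP; split => w /=.
    by move=> tw; have [b0|b0] := pselect (beta t w = 0); [right|left].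
  move=> [|[]//]; apply: contra_notP => /negP; rewrite -leNgt => wt.
  by rewrite /information_process max_r// divff ?gt_eqF// mul1r subrr.
apply: (@measurableU _ OG).
  have /(_ measurableT [set~ 0]) := information_adapted (ltW t0).
  by rewrite setTI; apply; exact: measurableC.
apply: filtration_null.
apply: negligibleS (information_neq0 W_bm tau_indep t0) => w /= [tw b0].
by move=> /(_ tw); rewrite b0 eqxx.
Qed.

(** An event of the completed filtration agrees almost everywhere with one that
    lies in the natural filtration at each time after [t]. *)
Lemma bayes_filtration (t u : R) (A : set Omega) : 0 < t ->
  <<s filtration_generators t >> A ->
  (\int[P]_(w in A `&` [set w | (t < tau w)%R])
     (posterior_tail tau t u (beta t w))%:E)%E =
  P (A `&` [set w | Num.max u t < tau w]).
Proof.
move=> t0 FA.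
have mA := filtration_sub FA.
have mE := measurable_alive tau.
have [B CB AB] := completion_approx (C_sigma t) FA.
have Bt s : t < s -> natural_filtration beta s B.
  by move=> ts; apply: CB; rewrite /= in_itv/= ts.
have mB : measurable B by apply: natural_filtration_sub (Bt (t + 1) _); rewrite ltrDl.
have ABE v : {ae P, forall w, (A `&` [set w | v < tau w]) w <->
    (B `&` [set w | v < tau w]) w}.
  by apply: filterS AB => w /=; tauto.
rewrite (ae_eq_set_integral _ _ _ _ (ABE t)).
- rewrite (ae_eq_set_probability _ _ (ABE (Num.max u t))).
  + exact: (bayes_right W_bm tau_indep).
  + by apply: measurableI => //; exact: mE.
  + by apply: measurableI => //; exact: mE.
- by apply: measurableI => //; exact: mE.
- by apply: measurableI => //; exact: mE.
- exact: (measurable_posterior_tail_information W_bm tau u t0).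
- by move=> w; rewrite lee_fin posterior_tail_ge0.
Qed.

Lemma cond_prob_posterior (t u : R) : 0 < t ->
  {ae P, forall w, t < tau w ->
    cond_prob P <<s filtration_generators t >> [set w' | u < tau w'] w =
    (posterior_tail tau t u (beta t w))%:E}.
Proof.
move=> t0; have mE := measurable_alive tau.
have [_ _ /adaptedE mY YE] := cond_probP P (filtration_sub (t := t)) (mE u).
apply: (ae_eq_integral_sub (filtration_sub (t := t))
  (E := [set w | t < tau w])) => //.
- exact: alive_adapted (ltW t0).
- apply/measurable_EFinP.
  apply: (measurableT_comp (measurable_posterior_tail tau u t0)).
  exact: information_adapted (ltW t0).
- move=> A FA AE; rewrite YE// integral_indic//; last exact: filtration_sub FA.
  rewrite -{2}(setIidl AE) bayes_filtration// setIC; congr (P _).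
  by apply/seteqP; split => w /= [Aw]; rewrite gt_max;
    [move=> ->; split => //; exact: AE|case/andP].
Qed.

Lemma posterior_tail_nonincreasing (t x : R) : 0 < t -> x != 0 ->
  nonincreasing_fun (fun u => posterior_tail tau t u x).
Proof.
move=> t0 x0 u v uv; apply: ler_wpM2r.
  by rewrite invr_ge0 fine_ge0// bridge_mass_ge0.
apply: fine_le; rewrite ?bridge_mass_fin_num//.
apply: ge0_subset_integral => //.
- apply/measurable_EFinP; apply: measurable_funTS.
  exact: (measurable_fun_pair1 x (measurable_bridge_density t0)).
- by move=> r _; rewrite lee_fin bridge_density_ge0.
- by move=> r /=; rewrite !in_itv/= !andbT; exact: le_lt_trans.
Qed.

(** Dominated convergence, the half-lines [ ]v n, +oo[ ] increasing to
    [ ]u, +oo[ ] as [v n] decreases to [u]. *)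
Lemma posterior_tail_right_continuous (t x : R) : 0 < t -> x != 0 ->
  right_continuous (fun u => posterior_tail tau t u x).
Proof.
move=> t0 x0 u; apply: cvgM; last exact: cvg_cst.
apply/cvg_at_rightP => v [uv vu]; apply: fine_cvg.
rewrite fineK ?bridge_mass_fin_num//.
have massE y : bridge_mass tau t y x =
    (\int[default_law tau]_r (bridge_density t r x * \1_(`]y, +oo[%classic : set (measurableTypeR R)) r)%:E)%E.
  rewrite /bridge_mass integral_mkcond; apply: eq_integral => r _.
  by rewrite patchE indicE; case: ifP => _; rewrite ?mulr1 ?mulr0.
rewrite massE; under eq_fun do rewrite massE.
have mbd : measurable_fun setT (fun r : measurableTypeR R => bridge_density t r x).
  exact: (measurable_fun_pair1 x (measurable_bridge_density t0)).
have mf y : measurable_fun setT (fun r : measurableTypeR R =>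
    (bridge_density t r x * \1_(`]y, +oo[%classic : set (measurableTypeR R)) r)%:E).
  by apply/measurable_EFinP; apply: measurable_funM.
have [] := @dominated_convergence _ _ _ (default_law tau) setT measurableT
  (fun n r => (bridge_density t r x * \1_(`]v n, +oo[%classic : set (measurableTypeR R)) r)%:E)
  (fun r => (bridge_density t r x * \1_(`]u, +oo[%classic : set (measurableTypeR R)) r)%:E)
  (EFin \o cst `|x|^-1) _ _ _
  (finite_measure_integrable_cst (default_law tau) _ measurableT) _ => //.
- apply: aeW => r _; apply: cvg_EFin; first exact: nearW.
  apply: cvgM; first exact: cvg_cst.
  have inE' y : \1_(`]y, +oo[%classic : set (measurableTypeR R)) r = (nat_of_bool (y < r))%:R :> R.
    rewrite indicE; congr (nat_of_bool _)%:R.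
    by apply/idP/idP; rewrite inE/= in_itv/= andbT.
  rewrite inE'; have [ru|ur] := leP r u.
    apply: cvg_near_cst; apply: nearW => n.
    by rewrite inE' ltNge (le_trans ru (ltW (uv n))).
  have h : \forall n \near \oo, v n < r by exact: (cvgr_lt u).
  apply: cvg_near_cst; near=> n.
  by rewrite /= inE' (near h n).
- apply: aeW => r n _; rewrite gee0_abs ?lee_fin ?mulr_ge0 ?bridge_density_ge0//.
  rewrite -[leRHS]mulr1 ler_pM ?bridge_density_ge0 ?bridge_density_le//.
Unshelve. all: by end_near. Qed.

Lemma posterior_survival_version (t : R) : 0 < t ->
  is_survival_version P <<s filtration_generators t >> tau t
    (posterior_survival tau beta t).
Proof.
move=> t0; split=> [u|].
  apply: filterS (cond_prob_posterior u t0) => w h tw.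
  by rewrite h// posterior_survivalE.
apply: filterS (information_neq0 W_bm tau_indep t0) => w h /h b0.
rewrite (_ : (fun u => _) = (fun u => posterior_tail tau t u (beta t w))).
  split; first exact: posterior_tail_nonincreasing.
  by move=> x; rewrite posterior_survivalE//; exact: posterior_tail_right_continuous.
by apply/funext => u; rewrite posterior_survivalE.
Qed.

End filtration.

(** * Mixtures and Stieltjes measures *)

Section mixture.
Context {d1 d2 : measure_display} {X : measurableType d1}
  {Y : measurableType d2} {R : realType}.
Variables (m : {measure set X -> \bar R}) (nu : {measure set Y -> \bar R}).
Variable kappa : X -> {measure set Y -> \bar R}.
Hypothesis mkappa :
  forall U, measurable U -> measurable_fun setT (fun x => kappa x U).
Hypothesis kappaE :
  forall U, measurable U -> (\int[m]_x kappa x U = nu U)%E.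
Local Open Scope ereal_scope.

Import HBNNSimple.

Let mixture_nnsfun (f : {nnsfun Y >-> R}) :
  \int[m]_x \int[kappa x]_y (f y)%:E = \int[nu]_y (f y)%:E.
Proof.
under eq_integral do rewrite integralT_nnsfun sintegralE.
rewrite integralT_nnsfun sintegralE ge0_integral_fsum//; last 2 first.
- by move=> r; apply: measurable_funeM; exact: mkappa.
- by move=> r x _; exact: nnsfun_mulemu_ge0.
apply: eq_fsbigr => r; rewrite inE => -[y _ <-].
rewrite ge0_integralZl ?kappaE// ?lee_fin//.
exact: mkappa.
Qed.

(** Simple functions first, by linearity, then increasing limits. *)
Lemma integral_mixture (f : Y -> \bar R) : (forall y, 0 <= f y) ->
  measurable_fun setT f ->
  \int[m]_x \int[kappa x]_y f y = \int[nu]_y f y.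
Proof.
move=> f0 mf; pose f_ := nnsfun_approx measurableT mf.
have lim_f (mu : {measure set Y -> \bar R}) :
    \int[mu]_y f y = limn (fun n => \int[mu]_y (f_ n y)%:E).
  rewrite -monotone_convergence//.
  - apply: eq_integral => y _; apply/esym/cvg_lim => //.
    exact: cvg_nnsfun_approx.
  - by move=> n; exact/measurable_EFinP.
  - by move=> n y _; rewrite lee_fin.
  - by move=> y _ a b ab; rewrite lee_fin; exact/lefP/nd_nnsfun_approx.
rewrite lim_f (_ : (fun n => _) =
    (fun n => \int[m]_x \int[kappa x]_y (f_ n y)%:E)); last first.
  by apply/funext => n; rewrite mixture_nnsfun.
rewrite -monotone_convergence//.
- by apply: eq_integral => x _; exact: lim_f.
- move=> n; apply: measurable_fun_integral_kernel => //.
  + by move=> y; rewrite lee_fin.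
  + exact/measurable_EFinP.
- by move=> n x _; apply: integral_ge0 => y _; rewrite lee_fin.
- move=> x _ a b ab; apply: ge0_le_integral => //.
  + by move=> y _; rewrite lee_fin.
  + exact/measurable_EFinP.
  + exact/measurable_EFinP.
  + by move=> y _; rewrite lee_fin; exact/lefP/nd_nnsfun_approx.
Qed.

End mixture.

Section integral_difference.
Context {d : measure_display} {T : measurableType d} {R : realType}.
Variables (m : {measure set T -> \bar R}) (A : set T).
Hypothesis mA : measurable A.
Local Open Scope ereal_scope.

(** If [f] has an infinite integral, so has [f - g], and both sides are [+oo]. *)
Lemma ge0_integralB_fin (f g : T -> \bar R) :
  measurable_fun A f -> (forall x, 0 <= f x) ->
  measurable_fun A g -> (forall x, 0 <= g x) ->
  (forall x, g x \is a fin_num) -> \int[m]_(x in A) g x < +oo ->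
  \int[m]_(x in A) (f x - g x) = \int[m]_(x in A) f x - \int[m]_(x in A) g x.
Proof.
move=> mf f0 mg g0 gfin goo.
have ge0_int h : measurable_fun A h -> (forall x, 0 <= h x) ->
    \int[m]_(x in A) h x < +oo -> m.-integrable A h.
  move=> mh h0 hoo; apply/integrableP; split => //.
  by under eq_integral do rewrite gee0_abs//.
have ig := ge0_int g mg g0 goo.
have [foo|] := boolP (\int[m]_(x in A) f x < +oo).
  by rewrite integralB//; exact: ge0_int.
rewrite -leNgt leye_eq => /eqP foo; rewrite foo.
have gfinI : \int[m]_(x in A) g x \is a fin_num.
  by rewrite ge0_fin_numE// integral_ge0.
rewrite addye; last by rewrite -fin_numN in gfinI; move: gfinI; case: (- _).
have mfg : measurable_fun A (fun x => f x - g x) by exact: emeasurable_funB.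
rewrite integralE.
have neg : \int[m]_(x in A) (fun x => f x - g x)^\- x < +oo.
  apply: le_lt_trans goo; apply: ge0_le_integral => //.
  - exact: measurable_funeneg.
  - move=> x _; rewrite funenegE ge_max g0 andbT.
    rewrite fin_num_oppeB// -[leRHS]add0e; apply: leeD => //.
    by rewrite oppe_le0.
have pos : \int[m]_(x in A) (fun x => f x - g x)^\+ x = +oo.
  apply/eqP; rewrite -leye_eq leNgt; apply/negP => posoo.
  have : \int[m]_(x in A) f x <
      +oo; last by rewrite foo.
  apply: (@le_lt_trans _ _ (\int[m]_(x in A) ((fun x => f x - g x)^\+ x + g x))).
    apply: ge0_le_integral => //.
    - by apply: emeasurable_funD => //; exact: measurable_funepos.
    - move=> x _; rewrite funeposE -[leLHS](@subeK _ (f x) (g x))//.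
      by rewrite leeD2r// le_max lexx.
  rewrite ge0_integralD//; first by rewrite lte_add_pinfty.
  exact: measurable_funepos.
rewrite pos addye//.
have : 0 <= \int[m]_(x in A) (fun x => f x - g x)^\- x by exact: integral_ge0.
by move: neg; case: (\int[m]_(x in A) _).
Qed.

End integral_difference.

Section stieltjes_facts.
Context {R : realType}.
Local Notation TR := (measurableTypeR R).
Local Open Scope ereal_scope.

Lemma lebesgue_stieltjes_measure_itv (g : cumulative R R) (a b : R) :
  (a <= b)%R -> lebesgue_stieltjes_measure g `]a, b]%classic = (g b - g a)%:E.
Proof.
move=> ab; rewrite /lebesgue_stieltjes_measure /measure_extension/=.
rewrite measurable_mu_extE/=; last exact: is_ocitv.
by rewrite wlength_itv_bnd.
Qed.

Lemma stieltjes_measure_itv (g : R -> R) (a b : R) :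
  nondecreasing g -> right_continuous g -> (a <= b)%R ->
  stieltjes_measure g `]a, b]%classic = (g b - g a)%:E.
Proof.
move=> ndg rcg ab; rewrite /stieltjes_measure; case: pselect => [h|]; last first.
  by move=> nh; exfalso; exact: nh.
exact: lebesgue_stieltjes_measure_itv.
Qed.

Lemma stieltjes_measure_itv_fin (g : R -> R) (a b : R) : (a <= b)%R ->
  stieltjes_measure g `]a, b]%classic < +oo.
Proof.
move=> ab; have [[ndg rcg]|ng] := pselect (nondecreasing g /\ right_continuous g).
  by rewrite stieltjes_measure_itv// ltry.
rewrite /stieltjes_measure; case: pselect => // _.
by apply: (@le_lt_trans _ _ 0); rewrite ?ltry.
Qed.

(** Both sides are the measure of the triangle [t <= v < s <= T] under the product
    of [dv] and [m (ds)]. *)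
Lemma integral_tail (m : {finite_measure set TR -> \bar R}) (t T : R) :
  (t <= T)%R ->
  \int[lebesgue_measure]_(v in `[t, T]) m `]v, T]%classic =
  \int[m]_(s in `]t, T]) (s - t)%:E.
Proof.
move=> tT.
pose D := [set vs : TR * TR | ((t <= vs.1)%R /\ (vs.1 < vs.2)%R) /\ (vs.2 <= T)%R].
have m1 : measurable_fun (setT : set (TR * TR)) (fun vs : TR * TR => vs.1 : R).
  exact: measurable_fst.
have m2 : measurable_fun (setT : set (TR * TR)) (fun vs : TR * TR => vs.2 : R).
  exact: measurable_snd.
have mD : measurable D.
  apply: measurableI; first apply: measurableI.
  - have := m1 measurableT _ (measurable_itv `[t, +oo[).
    rewrite setTI; congr measurable; apply/seteqP.
    by split => x /=; rewrite in_itv/= andbT.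
  - have m21 : measurable_fun (setT : set (TR * TR)) (fun vs : TR * TR => vs.2 - vs.1 : R)%R.
      exact: measurable_funB.
    have := m21 measurableT _ (measurable_itv `]0%R, +oo[).
    rewrite setTI; congr measurable; apply/seteqP.
    by split => x /=; rewrite in_itv/= andbT subr_gt0.
  - have := m2 measurableT _ (measurable_itv `]-oo, T]).
    by rewrite setTI.
have := indic_fubini_tonelli lebesgue_measure m mD.
rewrite indic_fubini_tonelli_FE// indic_fubini_tonelli_GE//.
rewrite [in X in X -> _](_ : m \o xsection D =
    (fun v => m `]v, T]%classic) \_ `[t, T]); last first.
  apply/funext => v; rewrite patchE /=; case: ifPn => [|].
    rewrite inE/= in_itv/= => /andP[tv vT]; congr (m _).
    apply/seteqP; split => s; rewrite /xsection/= inE /D/= in_itv/=.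
      by move=> [[_ ->] ->].
    by move=> /andP[-> ->].
  rewrite notin_setE/= in_itv/= => /negP tvT.
  rewrite (_ : xsection _ _ = set0) ?measure0//; apply/seteqP; split => s //.
  rewrite /xsection/= inE /D/= => -[[tv vs] sT]; apply: (negP tvT).
  by rewrite tv (le_trans (ltW vs)).
rewrite [in X in _ = X -> _](_ : lebesgue_measure \o ysection D =
    (fun s => (s - t)%:E) \_ `]t, T]); last first.
  apply/funext => s; rewrite patchE /=; case: ifPn => [|].
    rewrite inE/= in_itv/= => /andP[ts sT].
    rewrite (_ : ysection _ _ = `[t, s[%classic).
      by rewrite lebesgue_measure_itv/= lte_fin ts EFinB.
    apply/seteqP; split => v; rewrite /ysection/= inE /D/= in_itv/=.
      by move=> [[-> ->] _].
    by move=> /andP[-> ->].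
  rewrite notin_setE/= in_itv/= => /negP tsT.
  rewrite (_ : ysection _ _ = set0) ?measure0//; apply/seteqP; split => v //.
  rewrite /ysection/= inE /D/= => -[[tv vs] sT]; apply: (negP tsT).
  by rewrite sT (le_lt_trans tv).
by rewrite -!integral_mkcond.
Qed.

End stieltjes_facts.

(** * The conditional law of the default time before maturity *)

Section survival_kernel.
Context {d : measure_display} {Omega : measurableType d} {R : realType}.
Variables (P : probability Omega R) (G : set (set Omega)).
Hypothesis Gm : <<s G >> `<=` @measurable d Omega.
Hypothesis Gnull : P.-negligible `<=` <<s G >>.
Variables (tau : {RV P >-> R}) (t T : R).
Hypothesis tT : t <= T.
Hypothesis alive_G : <<s G >> [set w | t < tau w].
Variable Psi : R -> Omega -> R.
Hypothesis Psi_version : is_survival_version P <<s G >> tau t Psi.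
Local Notation OG := (g_sigma_algebraType G).
Local Notation TR := (measurableTypeR R).
Local Notation alive := [set w | t < tau w].

Let mD : measurable (`]t, T]%classic : set TR).
Proof. exact: measurable_itv. Qed.

(** Minus the differential of [Psi] on [ ]t, T] ]. After default the kernel is
    zero, since [Psi] says nothing there and the price vanishes. *)
Definition survival_kernel (w : Omega) : {measure set TR -> \bar R} :=
  if t < tau w
  then (mrestr (stieltjes_measure (fun v => - Psi v w)) mD : {measure set TR -> \bar R})
  else (mzero : {measure set TR -> \bar R}).

(** The interval is cut to [ ]t, T] ]; the outer maximum covers the case in which
    nothing is left of it. *)
Lemma survival_kernel_itv (w : Omega) (a b : R) : t < tau w ->
  nonincreasing_fun (Psi ^~ w) -> right_continuous (Psi ^~ w) ->
  let u := Num.max a t in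
  survival_kernel w `]a, b]%classic =
    (Psi u w - Psi (Num.max u (Num.min b T)) w)%:E.
Proof.
move=> tw ndP rcP u; rewrite /survival_kernel tw.
transitivity (stieltjes_measure (fun v => - Psi v w)
    `]u, Num.max u (Num.min b T)]%classic).
  rewrite /mrestr; congr (stieltjes_measure _ _).
  apply/seteqP; split => x /=; rewrite !in_itv/= gt_max le_max le_min.
    by move=> [/andP[-> ->] /andP[-> ->]]; rewrite orbT.
  move=> /andP[/andP[ax tx] /orP[xu|/andP[xb xT]]]; last by rewrite ax tx xb xT.
  by move: xu; rewrite leNgt gt_max ax tx.
have uu : u <= Num.max u (Num.min b T).
  by rewrite comparable_le_max ?lexx// real_comparable ?num_real.
rewrite stieltjes_measure_itv//.
- by rewrite opprK addrC.
- by move=> x y xy; rewrite lerN2; exact: ndP.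
- by move=> x; apply: cvgN; exact: rcP.
Qed.

Let proper_ae : {ae P, forall w, t < tau w ->
  nonincreasing_fun (Psi ^~ w) /\ right_continuous (Psi ^~ w)}.
Proof. exact: Psi_version.2. Qed.

Let mtail u : measurable [set w | u < tau w]. Proof. exact: measurable_alive. Qed.

(** A finite nonnegative version of the conditional probability of [u < tau],
    adapted for each [u], with which [Psi u] agrees almost everywhere on
    [t < tau]. *)
Let y u : Omega -> R :=
  xget (cst 0) [set y | (forall w, 0 <= y w) /\
    is_cond_exp P <<s G >> \1_[set w | u < tau w] (EFin \o y)].

Let yP u : (forall w, 0 <= y u w) /\
    is_cond_exp P <<s G >> \1_[set w | u < tau w] (EFin \o y u).
Proof.
rewrite /y; case: xgetP => // ny.
have [z z0 zP] := cond_prob_density P Gm (mtail u).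
by exfalso; exact: (ny z).
Qed.

Let y_ge0 u w : 0 <= y u w. Proof. exact: (yP u).1. Qed.

Let my u : measurable_fun (setT : set OG) (y u).
Proof. by have [_ [_ _ /adaptedE + _]] := yP u; move/measurable_EFinP. Qed.

Let int_y u A : <<s G >> A ->
  (\int[P]_(w in A) (y u w)%:E = P (A `&` [set w | (u < tau w)%R]))%E.
Proof.
move=> GA; have [_ [_ _ _ /(_ A GA)/= ->]] := yP u.
by rewrite integral_indic//; [rewrite setIC|exact: Gm].
Qed.

Let Psi_y u : {ae P, forall w, t < tau w -> Psi u w = y u w}.
Proof.
have h := cond_exp_ae_eq Gm (yP u).2.
apply: filterS2 h (Psi_version.1 u) => w h1 h2 tw.
by have := h2 tw; rewrite /cond_prob h1 => -[].
Qed.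

(** [survival_kernel _ U] is a version of the conditional probability of
    [tau \in U `&` ]t, T]]; measurability is required for itself, as an infinite
    sum and an integral will be exchanged. *)
Definition kernel_represents (U : set TR) :=
  measurable_fun (setT : set OG) (fun w => survival_kernel w U) /\
  forall A, <<s G >> A ->
    (\int[P]_(w in A) survival_kernel w U =
     P (A `&` tau @^-1` (U `&` `]t, T])))%E.

(** The difference of the survival probabilities at the two ends of the cut
    interval. *)
Let represents_itv a b : kernel_represents `]a, b].
Proof.
pose u1 := Num.max a t; pose u2 := Num.max u1 (Num.min b T).
have tu1 : t <= u1 by rewrite le_max lexx orbT.
have u12 : u1 <= u2 by rewrite le_max lexx.
have kE : {ae P, forall w, (\1_alive w * (y u1 w - y u2 w))%:E =
    survival_kernel w `]a, b]%classic}.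
  apply: filterS3 proper_ae (Psi_y u1) (Psi_y u2) => w pw P1 P2.
  have [tw|wt] := ltP t (tau w); last first.
    by rewrite /survival_kernel ltNge wt indicE memNset ?mul0r//= ltNge wt.
  have [ndP rcP] := pw tw.
  rewrite survival_kernel_itv// -/u1 -/u2 indicE mem_set// mul1r.
  by rewrite P1// P2.
have mk : measurable_fun (setT : set OG) (fun w => survival_kernel w `]a, b]%classic).
  apply: (ae_eq_adapted Gnull kE); apply/measurable_EFinP.
  apply: measurable_funM; last exact: measurable_funB.
  exact: measurable_indic.
split => // A GA.
have mA := Gm GA.
have mind u : measurable_fun A (fun w => (\1_alive w * y u w)%:E).
  apply: measurable_funTS; apply/measurable_EFinP; apply: measurable_funM.
    by apply: measurable_indic; exact: mtail.
  exact: (measurable_fun_sub Gm (my u)).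
have ind0 u w : (0 <= (\1_alive w * y u w)%:E)%E.
  by rewrite lee_fin mulr_ge0.
have int_ind u : t <= u -> (\int[P]_(w in A) (\1_alive w * y u w)%:E =
    P (A `&` [set w | (u < tau w)%R]))%E.
  move=> tu; rewrite (_ : A `&` _ = A `&` alive `&` [set w | u < tau w]).
    rewrite -int_y; last by apply: (@measurableI _ OG).
    rewrite [LHS]integral_mkcond [RHS]integral_mkcond; apply: eq_integral => w _.
    rewrite !patchE in_setI indicE.
    by case: (w \in A); case: (w \in _); rewrite /= ?mul1r ?mul0r.
  by apply/seteqP; split => w /= => [[? uw]|[[]]//]; split => //; split => //;
    exact: le_lt_trans uw.
have mk' : measurable_fun A (fun w => survival_kernel w `]a, b]%classic).
  by apply: measurable_funTS; exact: (measurable_fun_sub Gm mk).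
have : (\int[P]_(w in A) survival_kernel w `]a, b]%classic +
    P (A `&` [set w | (u2 < tau w)%R]) = P (A `&` [set w | (u1 < tau w)%R]))%E.
  rewrite -(int_ind u1)// -(int_ind u2); last exact: le_trans u12.
  rewrite -ge0_integralD//.
  apply: ge0_ae_eq_integral => //.
  - exact: emeasurable_funD.
  - by move=> w _; apply: adde_ge0.
  - apply: filterS kE => w <- _; rewrite -EFinD; congr EFin; ring.
have -> : A `&` [set w | u1 < tau w] =
   (A `&` tau @^-1` (`]a, b] `&` `]t, T])) `|` (A `&` [set w | u2 < tau w]).
  rewrite -setIUr; congr (_ `&` _); apply/seteqP; split => w /=.
    move=> u1w; have [u2w|wu2] := ltP u2 (tau w); first by right.
    left; have := u1w; rewrite /u1 gt_max !in_itv/= => /andP[-> ->]/=.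
    move: wu2; rewrite /u2 le_max le_min => /orP[wu|/andP[-> ->]//].
    by move: wu; rewrite leNgt u1w.
  move=> [[]|]; last exact: le_lt_trans.
  by rewrite !in_itv/= => /andP[aw _] /andP[tw _]; rewrite gt_max aw tw.
have mpre : measurable (A `&` tau @^-1` (`]a, b] `&` `]t, T])).
  apply: measurableI => //; rewrite -[X in measurable X]setTI.
  by apply: measurable_funPT => //; apply: measurableI; exact: measurable_itv.
have mAt : measurable (A `&` [set w | u2 < tau w]).
  by apply: measurableI => //; exact: mtail.
rewrite measureU//; last first.
  apply/seteqP; split => w //= [[_]]; rewrite !in_itv/=.
  move=> [/andP[_ wb] /andP[_ wT]] [_]; rewrite /u2 gt_max gt_min => /andP[_].
  by rewrite !ltNge wb wT.
have fin : P (A `&` [set w | u2 < tau w]) \is a fin_num by exact: fin_num_measure.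
by move=> /(congr1 (fun x => x - P (A `&` [set w | (u2 < tau w)%R]))%E); rewrite !addeK.
Qed.

Let kernel_setT w :
  survival_kernel w setT = survival_kernel w `]t, T]%classic.
Proof.
by rewrite /survival_kernel; case: ifP => // _; rewrite /= /mrestr setTI setIid.
Qed.

Lemma survival_kernel_fin w : (survival_kernel w setT < +oo)%E.
Proof.
rewrite kernel_setT /survival_kernel; case: ifP => // tw.
  by rewrite /= /mrestr setIid; exact: stieltjes_measure_itv_fin.
by rewrite ltry.
Qed.

Let represents_setT : kernel_represents setT.
Proof.
have [h1 h2] := represents_itv t T; split.
  by rewrite (_ : (fun _ => _) = (fun w => survival_kernel w `]t, T]%classic));
    [exact: h1|exact/funext/kernel_setT].
move=> A GA; rewrite setTI -[in RHS](setIid `]t, T]%classic) -h2//.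
by apply: eq_integral => w _; rewrite kernel_setT.
Qed.

Let represents_C U : measurable U -> kernel_represents U ->
  kernel_represents (~` U).
Proof.
move=> mU [mkU kU]; have [mkT kT] := represents_setT.
have kC w : survival_kernel w (~` U) =
    (survival_kernel w setT - survival_kernel w U)%E.
  have -> : (survival_kernel w setT =
      survival_kernel w (~` U) + survival_kernel w U)%E.
    rewrite -measureU ?setvU//; first exact: measurableC.
    exact: setICl.
  rewrite addeK// ge0_fin_numE//.
  apply: le_lt_trans (survival_kernel_fin w).
  by apply: le_measure; rewrite ?inE//; exact: measurableT.
have mkC : measurable_fun (setT : set OG) (fun w => survival_kernel w (~` U)).
  rewrite (_ : (fun _ => _) = (fun w => survival_kernel w setT - survival_kernel w U)%E).
    exact: emeasurable_funB.
  exact/funext/kC.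
split => // A GA.
have mA := Gm GA.
have mpre V : measurable V -> measurable (A `&` tau @^-1` (V `&` `]t, T])).
  move=> mV; apply: measurableI => //; rewrite -[X in measurable X]setTI.
  by apply: measurable_funPT => //; apply: measurableI.
have : (\int[P]_(w in A) survival_kernel w (~` U) +
    \int[P]_(w in A) survival_kernel w U =
    \int[P]_(w in A) survival_kernel w setT)%E.
  rewrite -ge0_integralD//; last 2 first.
  - by apply: measurable_funTS; exact: (measurable_fun_sub Gm mkC).
  - by apply: measurable_funTS; exact: (measurable_fun_sub Gm mkU).
  apply: eq_integral => w _; rewrite -measureU ?setvU//; last exact: setICl.
  exact: measurableC.
rewrite kU// kT//.
rewrite (_ : A `&` tau @^-1` (setT `&` _) =
  (A `&` tau @^-1` (~` U `&` `]t, T])) `|` (A `&` tau @^-1` (U `&` `]t, T]))).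
  rewrite measureU//; last 3 first.
  - by apply: mpre; exact: measurableC.
  - exact: mpre.
  - by apply/seteqP; split => w //= [[_ [nU _]] [_ [Uw _]]].
  have fin : P (A `&` tau @^-1` (U `&` `]t, T])) \is a fin_num.
    by apply: fin_num_measure; exact: mpre.
  move=> /(congr1 (fun x => x - P (A `&` tau @^-1` (U `&` `]t, T])))%E).
  by rewrite !addeK.
rewrite -setIUr -preimage_setU -setIUl setvU//.
Qed.

Let represents_bigcup (F : (set TR)^nat) : (forall n, measurable (F n)) ->
  trivIset setT F -> (forall n, kernel_represents (F n)) ->
  kernel_represents (\bigcup_n F n).
Proof.
move=> mF tF kF.
have kE w : survival_kernel w (\bigcup_n F n) =
    (\sum_(n <oo) survival_kernel w (F n))%E.
  by rewrite measure_bigcup//; apply: eq_eseriesl => n; rewrite in_setT.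
have mk n : measurable_fun (setT : set OG) (fun w => survival_kernel w (F n)).
  exact: (kF n).1.
split.
  rewrite (_ : (fun _ => _) = (fun w => \sum_(n <oo) survival_kernel w (F n))%E).
    by apply: ge0_emeasurable_sum.
  exact/funext/kE.
move=> A GA; have mA := Gm GA.
transitivity (\int[P]_(w in A) \sum_(n <oo) survival_kernel w (F n))%E.
  by apply: eq_integral => w _; exact: kE.
rewrite integral_nneseries//; last first.
  by move=> n; apply: measurable_funTS; exact: (measurable_fun_sub Gm (mk n)).
rewrite setI_bigcupl preimage_bigcup setI_bigcupr measure_bigcup//.
- rewrite [RHS](@eq_eseriesl _ _ xpredT); last by move=> n; rewrite in_setT.
  by apply: eq_eseriesr => n _; rewrite (kF n).2.
- move=> n _; apply: measurableI => //; rewrite -[X in measurable X]setTI.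
  by apply: measurable_funPT; [exact: measurableT|apply: measurableI; [exact: mF|exact: mD]].
- apply/trivIsetP => i j _ _ ij.
  move/trivIsetP : tF => /(_ i j Logic.I Logic.I ij) Fij.
  apply/seteqP; split => w //= [[_ [Fi _]] [_ [Fj _]]].
  by have : (F i `&` F j) (tau w) by []; rewrite Fij.
Qed.

(** Half-open intervals form a pi-system, and [represents_setT], [represents_C]
    and [represents_bigcup] make the represented sets a lambda-system. *)
Lemma survival_kernel_represents U : measurable U -> kernel_represents U.
Proof.
move=> mU.
apply: (@dynkin_induction _ TR R.-ocitv.-measurable kernel_represents) => //.
- move=> A B; exact: ocitvI.
- by move=> _ [[a b] _ <-]; exact: represents_itv.
Qed.

(** The law of [tau] under [P] restricted to [A] and [t < tau <= T] is the mixture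
    of the kernels over [A]. *)
Lemma integral_survival_kernel (g : TR -> \bar R) (A : set Omega) :
  (forall v, 0 <= g v)%E -> measurable_fun setT g -> <<s G >> A ->
  (\int[P]_(w in A) \int[survival_kernel w]_v g v =
   \int[P]_(w in A `&` tau @^-1` `]t, T]) g (tau w))%E.
Proof.
move=> g0 mg GA; have mA := Gm GA.
have mk U : measurable U -> measurable_fun setT (fun w => survival_kernel w U).
  by move=> mU; exact: (measurable_fun_sub Gm (survival_kernel_represents mU).1).
have mtau := measurable_default_time tau.
have mAD : measurable (A `&` tau @^-1` `]t, T]).
  apply: measurableI => //; rewrite -[X in measurable X]setTI.
  exact: mtau.
transitivity (\int[mrestr P mA]_w \int[survival_kernel w]_v g v)%E.
  rewrite ge0_integral_mrestr ?setTI//; last by move=> w; exact: integral_ge0.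
  exact: measurable_fun_integral_kernel.
rewrite (@integral_mixture _ _ _ _ _ _ (image_measure (mrestr P mAD) mtau))//.
- rewrite ge0_integral_pushforward//= preimage_setT.
  by rewrite ge0_integral_mrestr ?setTI//; exact: measurableT_comp.
- move=> U mU; rewrite ge0_integral_mrestr ?setTI//; last exact: mk.
  rewrite (survival_kernel_represents mU).2//.
  rewrite /image_measure /= /pushforward /mrestr; congr (P _).
  by rewrite preimage_setI setICA.
Qed.

Lemma integral_survival_kernel_adapted (g : TR -> \bar R) :
  (forall v, 0 <= g v)%E -> measurable_fun setT g ->
  measurable_fun (setT : set OG) (fun w => \int[survival_kernel w]_v g v)%E.
Proof.
move=> g0 mg; apply: measurable_fun_integral_kernel => // U mU.
exact: (survival_kernel_represents mU).1.
Qed.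

End survival_kernel.

(** * The price of the credit default swap *)

Section cds_price_formula.
Context {d : measure_display} {Omega : measurableType d} {R : realType}.
Variables (P : probability Omega R) (G : set (set Omega)).
Hypothesis Gm : <<s G >> `<=` @measurable d Omega.
Hypothesis Gnull : P.-negligible `<=` <<s G >>.
Variables (tau : {RV P >-> R}) (t T : R).
Hypothesis tT : t <= T.
Hypothesis alive_G : <<s G >> [set w | t < tau w].
Variable Psi : R -> Omega -> R.
Hypothesis Psi_version : is_survival_version P <<s G >> tau t Psi.
Variables (kappa : R) (delta : R -> R).
Hypothesis kappa_ge0 : 0 <= kappa.
Hypothesis mdelta : measurable_fun (`]t, T]%classic : set R) delta.
Hypothesis delta_ge0 : forall v, t < v <= T -> 0 <= delta v.
Local Notation OG := (g_sigma_algebraType G).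
Local Notation TR := (measurableTypeR R).
Local Notation kernel := (survival_kernel tau t T Psi).
Local Notation D := (`]t, T]%classic : set TR).

Let mD : measurable D. Proof. exact: measurable_itv. Qed.

(** The recovery and the fee per unit rate until default, both cut to
    [ ]t, T] ]. *)
Let recovery : TR -> \bar R := (EFin \o delta) \_ D.
Let elapsed : TR -> \bar R := (fun v => (v - t)%:E) \_ D.

Let recovery_ge0 v : (0 <= recovery v)%E.
Proof.
rewrite /recovery patchE; case: ifPn => //; rewrite inE/= in_itv/= => h.
by rewrite lee_fin delta_ge0.
Qed.

Let elapsed_ge0 v : (0 <= elapsed v)%E.
Proof.
rewrite /elapsed patchE; case: ifPn => //; rewrite inE/= in_itv/= => /andP[h _].
by rewrite lee_fin subr_ge0 ltW.
Qed.

Let elapsed_le v : (elapsed v <= (T - t)%:E)%E.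
Proof.
rewrite /elapsed patchE; case: ifPn => [|_]; last by rewrite lee_fin subr_ge0.
by rewrite inE/= in_itv/= => /andP[_ h]; rewrite lee_fin lerB.
Qed.

Let mrecovery : measurable_fun setT recovery.
Proof. by apply/(measurable_restrictT _ mD); exact/measurable_EFinP. Qed.

Let melapsed : measurable_fun setT elapsed.
Proof.
apply/(measurable_restrictT _ mD)/measurable_funTS/measurable_EFinP.
exact: measurable_funB.
Qed.

Definition cds_payoff (w : Omega) : R :=
  delta (tau w) * \1_[set w' | t < tau w' <= T] w -
  kappa * (Num.min (tau w) T - t) * \1_[set w' | t < tau w'] w.

(** [Num.min tau T - t] on [t < tau] and [0] elsewhere. The event [T < tau] is split
    off because the kernel does not see it. *)
Let fee w : \bar R :=
  (elapsed (tau w) + ((T - t) * \1_[set w' | T < tau w'] w)%:E)%E.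

Let fee_ge0 w : (0 <= fee w)%E.
Proof. by rewrite adde_ge0// lee_fin mulr_ge0// subr_ge0. Qed.

Let fee_fin w : fee w \is a fin_num.
Proof.
rewrite fin_numD andbT ge0_fin_numE//.
by apply: le_lt_trans (elapsed_le _) _; rewrite ltry.
Qed.

Let fee_le w : (fee w <= (T - t)%:E)%E.
Proof.
rewrite /fee indicE; have [Tw|wT] := ltP T (tau w).
  rewrite mem_set//= mulr1 /elapsed patchE memNset ?add0e//= in_itv/=.
  by rewrite (leNgt _ T) Tw andbF.
by rewrite memNset ?mulr0 ?adde0//= ltNge wT.
Qed.

Let payoffE w : (cds_payoff w)%:E = (recovery (tau w) - kappa%:E * fee w)%E.
Proof.
rewrite /cds_payoff EFinB; congr (_ - _)%E.
  rewrite /recovery patchE indicE /=; case: ifPn => [|].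
    by rewrite inE/= in_itv/= => h; rewrite mem_set// mulr1.
  by rewrite notin_setE/= in_itv/= => h; rewrite memNset ?mulr0.
rewrite -mulrA EFinM; congr (_ * _)%E.
rewrite /fee /elapsed patchE !indicE; have [tw|wt] := ltP t (tau w); last first.
  have nt : (t < tau w) = false by apply/negbTE; rewrite -leNgt.
  have nT : (T < tau w) = false by apply/negbTE; rewrite -leNgt (le_trans wt).
  by rewrite !memNset ?mulr0 ?adde0//= ?in_itv/= ?nt ?nT.
rewrite (mem_set (A := [set w' | t < tau w'])) ?mulr1//.
have [Tw|wT] := ltP T (tau w).
  have TwF : (tau w <= T) = false by apply/negbTE; rewrite -ltNge.
  by rewrite memNset/= ?in_itv/= ?TwF ?andbF// mem_set// mulr1 add0e.
have wTF : (T < tau w) = false by apply/negbTE; rewrite -leNgt.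
rewrite mem_set/= ?in_itv/= ?tw ?wT//.
by rewrite memNset ?mulr0 ?adde0//= wTF.
Qed.

Let mrec_tau : measurable_fun setT (fun w => recovery (tau w)).
Proof. exact: (measurableT_comp mrecovery (measurable_default_time tau)). Qed.

Let mela_tau : measurable_fun setT (fun w => elapsed (tau w)).
Proof. exact: (measurableT_comp melapsed (measurable_default_time tau)). Qed.

Let mlate : measurable_fun setT (fun w => ((T - t) * \1_[set w' | T < tau w'] w)%:E).
Proof.
apply/measurable_EFinP; apply: measurable_funM => //.
by apply: measurable_indic; exact: measurable_alive.
Qed.

Let mfee : measurable_fun setT fee.
Proof. exact: emeasurable_funD. Qed.

Let measurable_payoff : measurable_fun setT cds_payoff.
Proof.
apply/measurable_EFinP; rewrite (_ : _ \o _ =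
    (fun w => recovery (tau w) - kappa%:E * fee w)%E).
  by apply: emeasurable_funB => //; exact: measurable_funeM.
by apply/funext => w /=; exact: payoffE.
Qed.

Let int_fee_fin A : measurable A -> (\int[P]_(w in A) (kappa%:E * fee w) < +oo)%E.
Proof.
move=> mA; apply: (@le_lt_trans _ _ (\int[P]_(w in A) (kappa * (T - t))%:E)%E).
  apply: ge0_le_integral => //.
  - by move=> w _; rewrite mule_ge0// lee_fin.
  - by apply: measurable_funTS; exact: measurable_funeM.
  - by move=> w _; rewrite EFinM lee_pmul// lee_fin.
rewrite integral_cst// lte_mul_pinfty ?lee_fin ?mulr_ge0 ?subr_ge0//.
by rewrite -ge0_fin_numE// fin_num_measure.
Qed.

Let integral_kernel_restrict (f : TR -> \bar R) A :
  (forall v, 0 <= (f \_ D) v)%E -> measurable_fun setT (f \_ D) -> <<s G >> A ->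
  (\int[P]_(w in A) \int[kernel w]_v (f \_ D) v =
   \int[P]_(w in A) (f \_ D) (tau w))%E.
Proof.
move=> f0 mf GA.
rewrite (integral_survival_kernel Gm Gnull tT alive_G Psi_version)//.
rewrite [LHS]integral_mkcond [RHS]integral_mkcond.
apply: eq_integral => w _; rewrite [LHS]patchE [RHS]patchE in_setI.
case: (w \in A) => //=; case: ifPn => // /negP nD.
by rewrite patchE memNset// => wD; apply: nD; rewrite inE.
Qed.

Let integral_elapsed_fin w : (\int[kernel w]_v elapsed v)%E \is a fin_num.
Proof.
rewrite ge0_fin_numE ?integral_ge0//; apply: (@le_lt_trans _ _ (\int[kernel w]_v (T - t)%:E)%E).
    by apply: ge0_le_integral.
rewrite integral_cst// lte_mul_pinfty ?lee_fin ?subr_ge0//.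
exact: survival_kernel_fin.
Qed.

(** The kernel integrates what depends on a default before maturity. The fee due to
    [T < tau] enters through an adapted version of the probability of that
    event, equal to [Psi T] almost everywhere on [t < tau]. *)
Let price_density : exists2 Y : Omega -> \bar R, is_cond_exp P <<s G >> cds_payoff Y &
  {ae P, forall w, t < tau w -> Y w = (\int[kernel w]_v recovery v -
    kappa%:E * (\int[kernel w]_v elapsed v + ((T - t) * Psi T w)%:E))%E} /\
  forall w, tau w <= t -> Y w = 0%E.
Proof.
have [y y0 yP] := cond_prob_density P Gm (measurable_alive tau T).
have [_ _ /adaptedE my yE] := yP.
pose late w := ((T - t) * (\1_[set w' | t < tau w'] w * y w))%:E.
pose K (g : TR -> \bar R) w := (\int[kernel w]_v g v)%E.
have mK g : (forall v, 0 <= g v)%E -> measurable_fun setT g ->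
    measurable_fun (setT : set OG) (K g).
  exact: integral_survival_kernel_adapted.
have mlate' : measurable_fun (setT : set OG) late.
  apply/measurable_EFinP; apply: measurable_funM => //.
  apply: measurable_funM; last exact/measurable_EFinP.
  exact: measurable_indic.
have late0 w : (0 <= late w)%E by rewrite lee_fin !mulr_ge0// subr_ge0.
have K0 g w : (forall v, 0 <= g v)%E -> (0 <= K g w)%E by move=> g0; exact: integral_ge0.
have Kfin w : K elapsed w \is a fin_num by exact: integral_elapsed_fin.
have mKr := mK _ recovery_ge0 mrecovery.
have mKe := mK _ elapsed_ge0 melapsed.
have mfee' : measurable_fun (setT : set OG) (fun w => kappa%:E * (K elapsed w + late w))%E.
  by apply: measurable_funeM; exact: emeasurable_funD.
exists (fun w => K recovery w - kappa%:E * (K elapsed w + late w))%E; last split.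
- split => //.
  + right; apply: le_lt_trans (int_fee_fin measurableT).
    apply: ge0_le_integral => //.
    * by move=> w _; rewrite lee_fin le_max lexx orbT.
    * apply/measurable_EFinP; apply: measurable_maxr => //.
      exact: measurableT_comp.
    * exact: measurable_funeM.
    * move=> w _; rewrite EFin_max EFinN payoffE ge_max mule_ge0// andbT.
      rewrite fin_num_oppeB ?fin_numM// -[leRHS]add0e leeD2r//.
      by rewrite oppe_le0.
  + apply/adaptedE; exact: emeasurable_funB.
  + move=> A GA; have mA := Gm GA.
    have mKr' := measurable_fun_sub Gm mKr.
    have mKe' := measurable_fun_sub Gm mKe.
    have mlateO := measurable_fun_sub Gm mlate'.
    have feeE : (\int[P]_(w in A) (kappa%:E * (K elapsed w + late w)) =
        \int[P]_(w in A) (kappa%:E * fee w))%E.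
      rewrite ge0_integralZl//; last 2 first.
      * by apply: measurable_funTS; exact: emeasurable_funD.
      * by move=> w _; rewrite adde_ge0// K0.
      rewrite ge0_integralZl//; last by apply: measurable_funTS.
      congr (_ * _)%E.
      rewrite ge0_integralD//; last 3 first.
      * by move=> w _; exact: K0.
      * exact: measurable_funTS.
      * exact: measurable_funTS.
      rewrite /fee [RHS]ge0_integralD//; last 3 first.
      * exact: measurable_funTS.
      * by move=> w _; rewrite lee_fin mulr_ge0// subr_ge0.
      * exact: measurable_funTS.
      congr (_ + _)%E.
        exact: integral_kernel_restrict.
      have aliveE (f : Omega -> R) : measurable_fun setT f -> (forall w, 0 <= f w) ->
          (\int[P]_(w in A) ((T - t) * (\1_[set w' | t < tau w'] w * f w))%:E =
           (T - t)%:E * \int[P]_(w in A `&` [set w' | (t < tau w')%R]) (f w)%:E)%E.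
        move=> mf f0; under eq_integral do rewrite EFinM.
        rewrite ge0_integralZl//; last 3 first.
        * apply: measurable_funTS; apply/measurable_EFinP; apply: measurable_funM => //.
          by apply: measurable_indic; exact: measurable_alive.
        * by move=> w _; rewrite lee_fin mulr_ge0.
        * by rewrite lee_fin subr_ge0.
        congr (_ * _)%E; rewrite [LHS]integral_mkcond [RHS]integral_mkcond.
        apply: eq_integral => w _; rewrite !patchE in_setI indicE.
        by case: (w \in A); case: (w \in _); rewrite /= ?mul1r ?mul0r.
      have GAa : <<s G >> (A `&` [set w' | (t < tau w')%R]) by exact: (@measurableI _ OG).
      rewrite /late aliveE//; last first.
        by apply/measurable_EFinP; exact: (measurable_fun_sub Gm my).
      have /= -> := yE _ GAa.
      rewrite -aliveE//; last by apply: measurable_indic; exact: measurable_alive.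
      apply: eq_integral => w _; rewrite !indicE.
      have [Tw|wT] := boolP (w \in [set w' | T < tau w']); last by rewrite mulr0.
      by rewrite mem_set ?mul1r//=; move: Tw; rewrite inE/=; exact: le_lt_trans.
    rewrite ge0_integralB_fin//; last 6 first.
    * exact: measurable_funTS.
    * by move=> w; exact: K0.
    * by apply: measurable_funTS; exact: (measurable_fun_sub Gm mfee').
    * by move=> w; rewrite mule_ge0// ?lee_fin// adde_ge0// K0.
    * by move=> w; rewrite fin_numM// fin_numD Kfin.
    * by rewrite feeE; exact: int_fee_fin.
    rewrite feeE; under [RHS]eq_integral do rewrite payoffE.
    rewrite [RHS]ge0_integralB_fin//; last 5 first.
    * exact: measurable_funTS.
    * by apply: measurable_funTS; exact: measurable_funeM.
    * by move=> w; rewrite mule_ge0// lee_fin.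
    * by move=> w; rewrite fin_numM.
    * exact: int_fee_fin.
    congr (_ - _)%E.
    exact: integral_kernel_restrict.
- have h := cond_exp_ae_eq Gm yP.
  apply: filterS2 h (Psi_version.1 T) => w h1 h2 tw.
  have [yPsi] : (y w)%:E = (Psi T w)%:E by rewrite -h2.
  by rewrite /late indicE mem_set// mul1r yPsi.
- move=> w wt; have nt : (t < tau w) = false by apply/negbTE; rewrite -leNgt.
  rewrite /K /late /survival_kernel nt !integral_measure_zero indicE.
  by rewrite memNset/= ?nt// mul0r mulr0 add0e addr0 mulr0 oppr0.
Qed.

Let kernel_fin w : t < tau w -> (stieltjes_measure (fun v => (- Psi v w)%R) D < +oo)%E.
Proof. by move=> tw; exact: stieltjes_measure_itv_fin. Qed.

Let integral_kernel_restrictE (f : TR -> \bar R) w : t < tau w ->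
  (\int[kernel w]_v (f \_ D) v =
   \int[stieltjes_measure (fun v => (- Psi v w)%R)]_(v in D) f v)%E.
Proof.
move=> tw; rewrite -integral_mkcond; apply: eq_measure_integral => A mA AD.
by rewrite /survival_kernel tw /= /mrestr (setIidl AD).
Qed.

(** [Psi v - Psi T] is the mass that the kernel gives to [ ]v, T] ]. Hence
    [integral_tail] applies. *)
Let integral_survival w : t < tau w ->
  nonincreasing_fun (Psi ^~ w) -> right_continuous (Psi ^~ w) -> 0 <= Psi T w ->
  (\int[lebesgue_measure]_(v in `[t, T]) (Psi v w)%:E =
   \int[kernel w]_v elapsed v + ((T - t) * Psi T w)%:E)%E.
Proof.
move=> tw ndP rcP PT0.
pose m : {finite_measure set TR -> \bar R} := mfrestr mD (kernel_fin tw).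
have kE v : t <= v <= T -> (m `]v, T]%classic = (Psi v w - Psi T w)%:E)%E.
  move=> /andP[tv vT]; have := survival_kernel_itv T v T tw ndP rcP.
  rewrite /survival_kernel tw => ->.
  by rewrite (max_l tv) minxx (max_r vT).
rewrite /elapsed integral_kernel_restrictE//.
rewrite (@eq_measure_integral _ _ _ D m); last first.
  by move=> A mA AD; rewrite /m /= /mfrestr /mrestr (setIidl AD).
rewrite -integral_tail//.
transitivity (\int[lebesgue_measure]_(v in `[t, T]) (m `]v, T]%classic + (Psi T w)%:E))%E.
  apply: eq_integral => v; rewrite inE/= in_itv/= => vtT.
  by rewrite kE// -EFinD subrK.
rewrite ge0_integralD//.
- congr (_ + _)%E; rewrite integral_cst//= mulrC EFinM; congr (_ * _)%E.
  by rewrite lebesgue_measure_itv/= lte_fin; case: ltgtP tT => // <-; rewrite subrr.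
- apply: (eq_measurable_fun (fun v => (Psi v w - Psi T w)%:E)).
    by move=> v; rewrite inE/= in_itv/= => vtT; rewrite kE.
  apply/measurable_EFinP; apply: measurable_funB => //.
  exact: nonincreasing_measurable.
Qed.

Lemma cds_price_formula :
  {ae P, forall w, cond_exp P <<s G >> cds_payoff w =
    cds_formula tau kappa delta T t Psi w}.
Proof.
have [Y YP [Ya Yd]] := price_density.
have [y y0 yP] := cond_prob_density P Gm (measurable_alive tau T).
have yPsi : {ae P, forall w, t < tau w -> 0 <= Psi T w}.
  have h := cond_exp_ae_eq Gm yP.
  apply: filterS2 h (Psi_version.1 T) => w h1 h2 tw.
  by have := h2 tw; rewrite /cond_prob h1 => -[<-].
have PsiE : {ae P, forall w, t < tau w -> 0 <= Psi T w /\
    (nonincreasing_fun (Psi ^~ w) /\ right_continuous (Psi ^~ w))}.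
  by apply: filterS2 yPsi Psi_version.2 => w h1 h2 tw; split; [exact: h1|exact: h2].
apply: filterS3 (cond_exp_ae_eq Gm YP) Ya PsiE => w -> YE proper.
have [tw|wt] := ltP t (tau w); last first.
  by rewrite Yd// /cds_formula indicE memNset ?mul0e//= ltNge wt.
have [PT0 [ndP rcP]] := proper tw.
rewrite YE// /cds_formula indicE mem_set// mul1e /stieltjes_integral_decr oppeK.
congr (_ - _)%E; first exact: integral_kernel_restrictE.
rewrite -integral_survival// [RHS]EFinM; congr (_ * _)%E.
rewrite /Rintegral fineK// integral_survival//.
by rewrite fin_numD integral_elapsed_fin.
Qed.

End cds_price_formula.

(** With no discounting the fee is the rate times the length of the interval,
    which is reduced to a point after default. *)
Lemma cds_cashflow0 {d : measure_display} {Omega : measurableType d}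
    {R : realType} (P : probability Omega R) (tau : {RV P >-> R})
    (kappa : R) (delta : R -> R) (T t : R) : t <= T ->
  cds_cashflow kappa delta 0 T t tau = cds_payoff tau t T kappa delta.
Proof.
move=> tT; apply/funext => w; rewrite /cds_cashflow /cds_payoff.
rewrite mul0r oppr0 expR0 mul1r; congr (_ - _).
have le_min : Num.min t (tau w) <= Num.min T (tau w).
  by rewrite le_min !ge_min lexx tT/= orbT.
transitivity (kappa * (Num.min T (tau w) - Num.min t (tau w))).
  rewrite /Rintegral; under eq_integral do rewrite mul0r oppr0 expR0 mul1r.
  rewrite integral_cst//= lebesgue_measure_itv/= lte_fin; case: ltgtP le_min => //.
  by move=> -> _; rewrite subrr mulr0 mule0.
rewrite indicE; have [tw|wt] := ltP t (tau w).
  by rewrite mem_set// mulr1 minC.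
rewrite memNset/= ?ltNge ?wt// mulr0 min_r ?subrr ?mulr0//.
exact: le_trans tT.
Qed.

Theorem proposition8p2 (R : realType) (d : measure_display)
    (Omega : measurableType d) (P : probability Omega R)
    (P_complete : measure_is_complete P)
    (W : R -> Omega -> R) (W_bm : is_brownian_motion P W)
    (tau : {RV P >-> R}) (tau_gt0 : forall w, 0 < tau w)
    (tau_indep : independent_of_process P tau W)
    (tau_not_stopping : ~ is_stopping_time (completed_filtration P W) tau)
    (T kappa : R) (T_gt0 : 0 < T) (kappa_gt0 : 0 < kappa)
    (delta : R -> R) (delta_measurable : measurable_fun `[0, T] delta)
    (delta_ge0 : forall v, 0 <= v <= T -> 0 <= delta v)
    (t : R) (t_ge0 : 0 <= t) (t_leT : t <= T) :
  let beta := information_process W tau in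
  let Fbeta := right_completed_filtration P beta in
  let S := cds_price P Fbeta tau kappa delta 0 T in
  let Psi := posterior_survival tau beta t in
  [/\ {ae P, forall w, S t w =
        cond_exp P (Fbeta t) (fun w' =>
          delta (tau w') * \1_[set w'' | t < tau w'' <= T] w' -
          kappa * (Num.min (tau w') T - t) * \1_[set w'' | t < tau w''] w') w},
      (* [bridge_density] is only defined for positive times *)
      0 < t -> is_survival_version P (Fbeta t) tau t Psi /\
               {ae P, forall w, S t w = cds_formula tau kappa delta T t Psi w} &
      forall Psi' : R -> Omega -> R,
        is_survival_version P (Fbeta t) tau t Psi' ->
        {ae P, forall w, S t w = cds_formula tau kappa delta T t Psi' w}].
Proof.
move=> beta Fbeta S Psi.
have SE w : S t w = cond_exp P (Fbeta t) (cds_payoff tau t T kappa delta) w.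
  by rewrite /S /cds_price mul0r expR0 mul1e cds_cashflow0.
have price Psi' : is_survival_version P (Fbeta t) tau t Psi' ->
    {ae P, forall w, S t w = cds_formula tau kappa delta T t Psi' w}.
  move=> version; have kappa_ge0 := ltW kappa_gt0.
  have mdelta : measurable_fun (`]t, T]%classic : set R) delta.
    apply: measurable_funS delta_measurable => //.
    by apply: subset_itv => //; rewrite bnd_simp.
  have delta0 v : t < v <= T -> 0 <= delta v.
    by move=> /andP[tv vT]; rewrite delta_ge0// vT (le_trans t_ge0)// ltW.
  have sub : Fbeta t `<=` measurable by exact: filtration_sub.
  have null : P.-negligible `<=` Fbeta t by exact: filtration_null.
  have alive : Fbeta t [set w | t < tau w] by exact: alive_adapted.
  have := cds_price_formula sub null t_leT alive version kappa_ge0 mdelta delta0.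
  by apply: filterS => w <-; exact: SE.
split => [|t_gt0|//].
- exact: aeW.
- have version : is_survival_version P (Fbeta t) tau t Psi.
    exact: posterior_survival_version.
  by split => //; exact: price.
Qed.
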